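(* Suppose Assumptions 1, 2 and 3 of the context hold, with $B<\infty$ the density bound in Assumption 3, and suppose $\kappa=\gamma^2\Delta<1$. Set $c_\gamma=\frac{2}{1-\gamma^2}$ and $$C_1=\frac{3\,c_\gamma^2\,\vartheta}{(1-\kappa)^3}.$$ Then for all integers $0\le \ell<\ell'<\infty$, $$\big|\mathcal{E}(\ell)-\mathcal{E}(\ell')\big|\;\le\;3\,B^{2/3}\,C_1^{1/3}\,\kappa^{(\ell+1)/3}.$$ In particular, $\mathcal{E}(\infty):=\lim_{\ell'\to\infty}\mathcal{E}(\ell')$ exists, and $|\mathcal{E}(\ell)-\mathcal{E}(\infty)|\le 3B^{2/3}C_1^{1/3}\kappa^{(\ell+1)/3}$ for every $\ell\ge 0$. Moreover, $T_\ell$ converges in $L^2$ to a limit statistic $T_\infty$ (i.e. $\mathbb{E}[(T_\ell-T_\infty)^2]\to 0$ as $\ell\to\infty$), and $\mathcal{E}(\infty)=\mathbb{P}(y_o T_\infty\le 0)$.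
   Context: Parameters. Constants $a>b>0$; $\Delta=\frac{a+b}{2}$, assumed $>1$; $\gamma=\frac{a-b}{a+b}\in(0,1)$; $\kappa=\gamma^2\Delta$. Limit object $(T,o,y,X)$. $T$ is a Poisson Galton--Watson tree rooted at $o$: every vertex independently has $\mathrm{Poi}(\Delta)$ children. Labels $y_v\in\{\pm1\}$ follow a broadcast process: $y_o$ is uniform on $\{\pm1\}$ and, independently along edges and of the tree shape, each child has its parent's label with probability $\frac{1+\gamma}{2}$ and the opposite label with probability $\frac{1-\gamma}{2}$. Given the tree and labels, the features $X_v\in\mathbb{R}^d$ are independent with $X_v\sim\mathbb{P}_{y_v}$, where $\mathbb{P}_+,\mathbb{P}_-$ are two given probability laws on $\mathbb{R}^d$. $N_k$ is the set of vertices at graph distance exactly $k$ from $o$. All probabilities and expectations are on this object. Features and classifier. $\rho_\pm$ are the densities of $\mathbb{P}_\pm$ with respect to a common base measure $\mu$; $\psi=\rho_+/\rho_-$; $t(x)=\frac{\rho_+(x)-\rho_-(x)}{\rho_+(x)+\rho_-(x)}\in[-1,1]$, so $\log\psi=2\operatorname{artanh}(t)$. For $k\ge0$, $M_k(x)=2\operatorname{artanh}(\gamma^k t(x))$. For $\ell\ge 0$, $$T_\ell=\sum_{k=0}^{\ell}\sum_{v\in N_k}M_k(X_v),\qquad \mathcal{E}(\ell)=\mathbb{P}(y_oT_\ell\le 0)$$ (ties count as errors). $\mathbb{E}_+$ denotes expectation under $X\sim\mathbb{P}_+$. Assumption 1. $\mathbb{P}_+$ and $\mathbb{P}_-$ are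 mutually absolutely continuous, with densities $\rho_\pm$ with respect to $\mu$, and there is a $\mu$-measure-preserving involution $\tau:\mathbb{R}^d\to\mathbb{R}^d$ with $\rho_-(x)=\rho_+(\tau(x))$ for $\mu$-a.e. $x$. Assumption 2. $\vartheta:=\mathbb{E}_+[t(X)^2]>0$. Assumption 3. Under $X\sim\mathbb{P}_+$, the random variable $\log\psi(X)$ has a density on $\mathbb{R}$ bounded by $B<\infty$. *)

(* Defs.v *)
From HB Require Import structures.
From mathcomp Require Import all_boot all_order all_algebra finmap.
From mathcomp Require Import all_classical all_reals all_analysis.

Set Implicit Arguments.
Unset Strict Implicit.
Unset Printing Implicit Defensive.

Import Order.TTheory GRing.Theory Num.Theory.
Import numFieldNormedType.Exports.

Local Open Scope classical_set_scope.
Local Open Scope ring_scope.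

(* Ulam-Harris coding: the empty word is the root o, and [rcons v i] is the
   i-th potential child of v. Given offspring numbers [K], the i-th child of a
   tree vertex v belongs to the tree iff i < K v. *)
Definition vertex := seq nat.

Definition parent (v : vertex) : vertex := take (size v).-1 v.

(* N_k, listed without repetition *)
Fixpoint generation (K : vertex -> nat) (k : nat) : seq vertex :=
  if k is k'.+1 then
    flatten [seq [seq rcons v i | i <- iota 0 (K v)] | v <- generation K k']
  else [:: [::]].

(* Labels are encoded by booleans, true standing for +1. *)
Definition sgl (R : realType) (b : bool) : R := if b then 1 else -1.

Definition mutually_independent (dO : measure_display)
    (Omega : measurableType dO) (R : realType) (P : probability Omega R)
    (I : choiceType) (F : I -> set (set Omega)) : Prop :=
  forall (J : {fset I}) (A : I -> set Omega),
    (forall i, i \in J -> F i (A i)) ->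
    P (\bigcap_(i in [set` J]) A i) = (\prod_(i <- J) P (A i))%E.

(* The root label, and at every other vertex the indicator that its label
   agrees with that of its parent. *)
Definition innovation (Omega : Type) (y : vertex -> Omega -> bool)
    (v : vertex) (w : Omega) : bool :=
  if v is [::] then y v w else y v w == y (parent v) w.

(* [K], [y], [X] realize the Poisson Galton-Watson tree with broadcast labels
   and features on the probability space [P]. Offspring numbers, labels and
   features are attached to every word; only those of the words that are
   vertices of the tree are ever used.
   [features_cond_indep] says that, conditionally on the sigma-algebra
   generated by all offspring numbers and labels, the X_v are independent
   with X_v of law P_(y_v). *)
Record is_limit_object (R : realType) (d : nat) (dO : measure_display)
    (Omega : measurableType dO) (P : probability Omega R) (Delta gamma : R)
    (Pp Pm : probability (d.-tuple R) R)
    (K : vertex -> {RV P >-> nat}) (y : vertex -> {RV P >-> bool})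
    (X : vertex -> {RV P >-> d.-tuple R}) : Prop := {
  offspring_innovations_indep :
    mutually_independent P (fun i : vertex + vertex =>
      match i with
      | inl v => g_sigma_algebra_preimage (K v)
      | inr v => g_sigma_algebra_preimage (innovation y v)
      end);
  offspring_poisson : forall v k,
    P (K v @^-1` [set k]) = (poisson_pmf Delta k)%:E;
  root_label_uniform : forall s : bool,
    P (y [::] @^-1` [set s]) = (2^-1)%:E;
  child_label_agrees : forall v i,
    P [set w | y (rcons v i) w = y v w] = ((1 + gamma) / 2)%:E;
  features_cond_indep : forall (E : set Omega) (J : {fset vertex})
      (A : vertex -> set (d.-tuple R)),
    <<s \bigcup_v (g_sigma_algebra_preimage (K v) `|`
                   g_sigma_algebra_preimage (y v)) >> E ->
    (forall v, measurable (A v)) ->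
    P (E `&` \bigcap_(v in [set` J]) (X v @^-1` A v)) =
    (\int[P]_(w in E) \prod_(v <- J) (if y v w then Pp else Pm) (A v))%E }.

Definition artanh (R : realType) (x : R) : R := ln ((1 + x) / (1 - x)) / 2.

(* log psi; the conventions ln 0 = 0 and x / 0 = 0 only matter on a set that is
   null for both P_+ and P_- when these are mutually absolutely continuous. *)
Definition log_psi (R : realType) (T : Type) (rp rm : T -> R) (x : T) : R :=
  ln (rp x / rm x).

Definition tstat (R : realType) (T : Type) (rp rm : T -> R) (x : T) : R :=
  (rp x - rm x) / (rp x + rm x).

Definition Mk (R : realType) (T : Type) (rp rm : T -> R) (gamma : R) (k : nat)
    (x : T) : R :=
  2 * artanh (gamma ^+ k * tstat rp rm x).

Definition Tell (R : realType) (Omega T : Type) (rp rm : T -> R) (gamma : R)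
    (K : vertex -> Omega -> nat) (X : vertex -> Omega -> T) (l : nat)
    (w : Omega) : R :=
  \sum_(k < l.+1) \sum_(v <- generation (fun u => K u w) k)
    Mk rp rm gamma k (X v w).

(* P(y_o S <= 0) *)
Definition error_prob (dO : measure_display) (Omega : measurableType dO)
    (R : realType) (P : probability Omega R) (yo : Omega -> bool)
    (S : Omega -> R) : R :=
  fine (P [set w | sgl R (yo w) * S w <= 0]).

Definition is_density (dT : measure_display) (T : measurableType dT)
    (R : realType) (mu : {measure set T -> \bar R})
    (Q : set T -> \bar R) (r : T -> R) : Prop :=
  [/\ measurable_fun setT r, (forall x, 0 <= r x) &
      forall A, measurable A -> Q A = (\int[mu]_(x in A) (r x)%:E)%E].

Record assumption1 (R : realType) (dT : measure_display)
    (T : measurableType dT) (mu : {measure set T -> \bar R})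
    (Pp Pm : probability T R) (rp rm : T -> R) : Prop := {
  mutual_ac : Pp `<< Pm /\ Pm `<< Pp;
  density_p : is_density mu Pp rp;
  density_m : is_density mu Pm rm;
  symmetry : exists tau : T -> T,
    [/\ measurable_fun setT tau,
        (forall A, measurable A -> mu (tau @^-1` A) = mu A),
        involutive tau &
        {ae mu, forall x, rm x = rp (tau x)}] }.

(* vartheta = E_+[t(X)^2] *)
Definition vartheta (R : realType) (dT : measure_display)
    (T : measurableType dT) (Pp : probability T R) (rp rm : T -> R) : R :=
  fine ('E_Pp[(fun x => tstat rp rm x ^+ 2)%R])%E.

Definition assumption3 (R : realType) (dT : measure_display)
    (T : measurableType dT) (Pp : probability T R) (rp rm : T -> R)
    (B : R) : Prop :=
  exists2 f : R -> R, (forall z, f z <= B) &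
    is_density lebesgue_measure (pushforward Pp (log_psi rp rm)) f.

(* Main.v *)
(* An error of T_l that is not an error of S forces |T_l| <= s or |S - T_l| >= s.
   The root feature enters T_l through M_0 = log psi and is conditionally
   independent of the rest, so the first event has probability at most 2 B s;
   the second has probability at most E[(S - T_l)^2] / s^2 by Markov, and s is
   optimized.
   For S = T_l' the second moment is computed on the tree with offspring numbers
   cut at n, where all sums over words are finite: given the tree and the labels,
   M_k(X_u) and M_m(X_v) have mean proportional to y_u and y_v, and the
   correlation of the labels over the two generations satisfies a recursion at
   the root whose solution is bounded by a power of kappa. Fatou's lemma removes
   the cut-off. The same bounds make T_l converge almost surely and in L^2, so
   that the comparison also applies to the limit S = T_infinity. *)
Require Import Defs.
From HB Require Import structures.
From mathcomp Require Import all_boot all_order all_algebra finmap.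
From mathcomp Require Import all_classical all_reals all_analysis.
From mathcomp Require Import measurable_realfun ring lra.

Set Implicit Arguments.
Unset Strict Implicit.
Unset Printing Implicit Defensive.

Import Order.TTheory GRing.Theory Num.Theory.
Import numFieldNormedType.Exports.

Local Open Scope classical_set_scope.
Local Open Scope ring_scope.

(** The power of kappa comes from sorting pairs of vertices by their last common ancestor. For u and
    v in generations k and m with this ancestor at depth j, the expected number of pairs is at most
    Delta^(k+m-j), the labels have correlation gamma^(k+m-2j), and the damping inside M_k and M_m
    gives another gamma^(k+m): the contribution is kappa^(k+m-j). Summing over j <= min(k,m) leaves
    kappa^max(k,m) as leading term, and summing over k, m > l leaves kappa^(l+1).

    Nothing is assumed about moments of M_0 = log psi. It cancels in T_l' - T_l, so second moments
    involve only k >= 1, where |M_k| <= c_gamma gamma^k |t| is bounded; M_0 matters only through its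
    density.

    A generation is a random list, so expectation does not commute with a sum over it. Cutting the
    offspring at n turns the sum into one over a fixed list of words weighted by indicators, and the
    Poisson moments then enter as sums of tails P(K > i). Independence is given on events only,
    which is why label correlations are written as products of two-valued factors, each attached to
    a different variable. *)

(** * Bounded measurable functions and linearity of the real-valued integral on them *)

Definition bounded_mfun (dT : measure_display) (T : measurableType dT)
    (R : realType) (f : T -> R) : Prop :=
  measurable_fun setT f /\ exists C, forall x, `|f x| <= C.

Section bounded_mfun.
Context (dT : measure_display) (T : measurableType dT) (R : realType).
Implicit Types f g : T -> R.

Lemma bounded_mfun_cst (c : R) : bounded_mfun (fun _ : T => c).
Proof. by split => //; exists `|c|. Qed.

Lemma bounded_mfun_indic (A : set T) :
  measurable A -> bounded_mfun (\1_A : T -> R).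
Proof.
move=> mA; split; first exact: measurable_indic.
by exists 1 => x; rewrite indicE; case: (_ \in _); rewrite ?normr1 ?normr0.
Qed.

Lemma bounded_mfunD f g :
  bounded_mfun f -> bounded_mfun g -> bounded_mfun (fun x => f x + g x).
Proof.
move=> [mf [C fC]] [mg [D gD]]; split; first exact: measurable_funD.
by exists (C + D) => x; rewrite (le_trans (ler_normD _ _))// lerD.
Qed.

Lemma bounded_mfunM f g :
  bounded_mfun f -> bounded_mfun g -> bounded_mfun (fun x => f x * g x).
Proof.
move=> [mf [C fC]] [mg [D gD]]; split; first exact: measurable_funM.
by exists (C * D) => x; rewrite normrM ler_pM.
Qed.

Lemma bounded_mfun_sum (I : Type) (s : seq I) (f : I -> T -> R) :
  (forall i, bounded_mfun (f i)) -> bounded_mfun (fun x => \sum_(i <- s) f i x).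
Proof.
move=> bf; elim: s => [|i s IH].
  by under eq_fun do rewrite big_nil; exact: bounded_mfun_cst.
by under eq_fun do rewrite big_cons; exact: bounded_mfunD.
Qed.

Lemma bounded_mfun_prod (I : Type) (s : seq I) (f : I -> T -> R) :
  (forall i, bounded_mfun (f i)) -> bounded_mfun (fun x => \prod_(i <- s) f i x).
Proof.
move=> bf; elim: s => [|i s IH].
  by under eq_fun do rewrite big_nil; exact: bounded_mfun_cst.
by under eq_fun do rewrite big_cons; exact: bounded_mfunM.
Qed.

Lemma bounded_mfun_integrable (m : {finite_measure set T -> \bar R}) f :
  bounded_mfun f -> m.-integrable setT (EFin \o f).
Proof.
move=> [mf [C fC]]; apply: measurable_bounded_integrable => //.
- by rewrite ltey_eq fin_num_measure.
- exists C; split; rewrite ?num_real// => M CM x _ /=.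
  exact: le_trans (fC x) (ltW CM).
Qed.

End bounded_mfun.

Section expectation_bounded.
Context (dT : measure_display) (T : measurableType dT) (R : realType).
Variable P : probability T R.
Implicit Types f g : T -> R.

Lemma Rintegral_bounded_mfunD f g : bounded_mfun f -> bounded_mfun g ->
  \int[P]_x (f x + g x) = \int[P]_x f x + \int[P]_x g x.
Proof. by move=> bf bg; rewrite RintegralD//; exact: bounded_mfun_integrable. Qed.

Lemma Rintegral_bounded_mfunZ (c : R) f : bounded_mfun f ->
  \int[P]_x (c * f x) = c * \int[P]_x f x.
Proof. by move=> bf; rewrite RintegralZl//; exact: bounded_mfun_integrable. Qed.

Lemma Rintegral_probability_cst (c : R) : \int[P]_x c = c.
Proof.
by rewrite Rintegral_cst//=; have -> := @probability_setT _ _ _ P; rewrite mulr1.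
Qed.

Lemma Rintegral_bounded_mfun_sum (I : Type) (s : seq I) (f : I -> T -> R) :
  (forall i, bounded_mfun (f i)) ->
  \int[P]_x (\sum_(i <- s) f i x) = \sum_(i <- s) \int[P]_x f i x.
Proof.
move=> bf; elim: s => [|i s IH].
  by under eq_Rintegral do rewrite big_nil; rewrite Rintegral_probability_cst big_nil.
under eq_Rintegral do rewrite big_cons.
by rewrite Rintegral_bounded_mfunD// ?IH ?big_cons//; exact: bounded_mfun_sum.
Qed.

Lemma Rintegral_indic (A : set T) : measurable A ->
  \int[P]_x \1_A x = fine (P A).
Proof. by move=> mA; rewrite /Rintegral integral_indic// setIT. Qed.

End expectation_bounded.

(** * Expectation of a product of independent two-valued factors *)

Section independent_factors.
Context (dT : measure_display) (T : measurableType dT) (R : realType).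
Variables (P : probability T R) (I : choiceType) (F : I -> set (set T)).
Hypothesis Fm : forall i, F i `<=` measurable.
Hypothesis Find : mutually_independent P F.

Lemma mutually_independent_seq (s : seq I) (A : I -> set T) :
  uniq s -> (forall i, i \in s -> F i (A i)) ->
  \int[P]_x (\prod_(i <- s) \1_(A i) x) = \prod_(i <- s) fine (P (A i)).
Proof.
move=> us FA.
have prm : perm_eq [fset i in s]%fset s.
  by apply: uniq_perm => // i; rewrite in_fset.
have FA' i : i \in [fset i in s]%fset -> F i (A i) by rewrite in_fset; exact: FA.
have := Find FA'; rewrite (perm_big _ prm)/= => E.
have mA : measurable (\bigcap_(i in [set` [fset i in s]%fset]) A i).
  apply: fin_bigcap_measurable => // i /FA'; exact: Fm.
transitivity (\int[P]_x \1_(\bigcap_(i in [set` [fset i in s]%fset]) A i) x).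
  apply: eq_Rintegral => x _; rewrite indicE.
  have [xA|nxA] := boolP (x \in _).
    rewrite big_seq big1// => i si; rewrite indicE mem_set//.
    by move/set_mem: xA => /(_ i); apply; rewrite /= in_fset.
  have /existsNP[i /not_implyP[/= si nAi]] :
      ~ (forall i, i \in [fset i in s]%fset -> A i x).
    by move=> H; move/negP: nxA; apply; rewrite inE => i /= /H.
  rewrite in_fset in si.
  by rewrite (bigD1_seq i)//= indicE memNset// mul0r.
rewrite Rintegral_indic// E.
rewrite -[RHS]/(fine (\prod_(i <- s) fine (P (A i)))%:E); congr fine.
rewrite -prodEFin big_seq [RHS]big_seq; apply: eq_bigr => i si.
by rewrite fineK// fin_num_measure//; exact/Fm/FA.
Qed.

(** Each factor is a combination of two indicators, so expanding the product multilinearly reduces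
    the claim to independence of events. Distinct keys guarantee that no variable is used twice. *)
Lemma independent_factors (J : eqType) (s : seq J) (key : J -> I)
    (f : J -> T -> R) :
  uniq (map key s) ->
  (forall j, exists A B a b, [/\ F (key j) A, F (key j) B &
      f j = fun x => a * \1_A x + b * \1_B x]) ->
  \int[P]_x (\prod_(j <- s) f j x) = \prod_(j <- s) \int[P]_x f j x.
Proof.
move=> us fE.
have bF i A : F i A -> bounded_mfun (\1_A : T -> R).
  by move=> FA; exact/bounded_mfun_indic/Fm/FA.
have bf j : bounded_mfun (f j).
  have [A [B [a [b [FA FB ->]]]]] := fE j.
  by apply: bounded_mfunD; apply: bounded_mfunM;
    [exact: bounded_mfun_cst|exact: bF FA|
     exact: bounded_mfun_cst|exact: bF FB].
(* The induction carries along the indicators of the events ([s'], [A]) already chosen from expanded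
   factors; when [s] is exhausted only indicators remain. *)
suff gen (s' : seq I) (A : I -> set T) : uniq (map key s ++ s') ->
    (forall i, i \in s' -> F i (A i)) ->
    \int[P]_x (\prod_(j <- s) f j x * \prod_(i <- s') \1_(A i) x) =
    \prod_(j <- s) \int[P]_x f j x * \prod_(i <- s') fine (P (A i)).
  have := gen [::] (fun=> set0); rewrite cats0 big_nil mulr1 => <- //.
  by apply: eq_Rintegral => x _; rewrite big_nil mulr1.
elim: s s' A {us} => [|j s IH] s' A /=.
  move=> us' FA; rewrite big_nil mul1r.
  under eq_Rintegral do rewrite big_nil mul1r.
  exact: mutually_independent_seq.
move=> /andP[njs us] FA.
move: (njs); rewrite mem_cat negb_or => /andP[_ njs'].
have step B : F (key j) B ->
    \int[P]_x (\1_B x * (\prod_(j <- s) f j x * \prod_(i <- s') \1_(A i) x)) =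
    fine (P B) * (\prod_(j <- s) \int[P]_x f j x *
                  \prod_(i <- s') fine (P (A i))).
  (* Overriding [A] at [key j] leaves the other chosen events unchanged, because [key j] is not in
     [s']. *)
  move=> FB; pose A' i := if i == key j then B else A i.
  have A'E (G : set T -> R) :
      \prod_(i <- s') G (A' i) = \prod_(i <- s') G (A i).
    rewrite big_seq [RHS]big_seq; apply: eq_bigr => i is'; rewrite /A' ifN//.
    by apply: contraNneq njs' => <-.
  have := IH (key j :: s') A'.
  rewrite big_cons (A'E (fun A => fine (P A))) /A' eqxx mulrCA => <-.
  - apply: eq_Rintegral => x _.
    by rewrite big_cons -/A' (A'E (fun A => \1_A x)) eqxx mulrCA.
  - by rewrite uniq_catC/= uniq_catC us andbT mem_cat orbC -mem_cat.
  - move=> i; rewrite inE => /predU1P[->|is']; first by rewrite eqxx.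
    by case: eqP => [->//|_]; exact: FA.
have bA : bounded_mfun (fun x => \prod_(i <- s') \1_(A i) x : R).
  have -> : (fun x => \prod_(i <- s') \1_(A i) x : R) =
      fun x => \prod_(i <- s') (if i \in s' then \1_(A i) x else 0).
    by apply/funext => x; rewrite big_seq [RHS]big_seq; apply: eq_bigr => i ->.
  apply: bounded_mfun_prod => i; have [is'|_] := boolP (i \in s').
    exact: bF (FA _ is').
  exact: bounded_mfun_cst.
have bG : bounded_mfun (fun x =>
    \prod_(j <- s) f j x * \prod_(i <- s') \1_(A i) x).
  by apply: bounded_mfunM => //; exact: bounded_mfun_prod.
have [A1 [B1 [a [b [FA1 FB1 fj]]]]] := fE j.
have ind B : F (key j) B -> bounded_mfun (fun x => \1_B x *
    (\prod_(j <- s) f j x * \prod_(i <- s') \1_(A i) x) : R).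
  by move=> FB; apply: bounded_mfunM => //; exact: bF FB.
rewrite big_cons -mulrA.
under eq_Rintegral do rewrite big_cons -mulrA {1}fj mulrDl -!mulrA.
rewrite Rintegral_bounded_mfunD; try by
  apply: bounded_mfunM; [exact: bounded_mfun_cst|exact: ind].
rewrite !Rintegral_bounded_mfunZ; try exact: ind.
rewrite !step// fj.
rewrite Rintegral_bounded_mfunD; try by
  apply: bounded_mfunM; [exact: bounded_mfun_cst|apply: bF; eassumption].
rewrite !Rintegral_bounded_mfunZ; try by apply: bF; eassumption.
rewrite !Rintegral_indic; try by [exact: Fm FA1|exact: Fm FB1].
by rewrite mulrDl !mulrA.
Qed.

End independent_factors.

(** * Generations of truncated trees *)

(** The complete n-ary tree contains every truncated tree, and its generations do not depend on the
    sample point. *)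
Definition words (n k : nat) : seq vertex := generation (fun=> n) k.

Fixpoint intree (K : vertex -> nat) (w u : vertex) : bool :=
  if u is i :: u' then (i < K w)%N && intree K (rcons w i) u' else true.

Lemma intree_rcons K w u i :
  intree K w (rcons u i) = intree K w u && (i < K (w ++ u))%N.
Proof.
elim: u w => [|j u IH] w /=; first by rewrite cats0 andbT.
by rewrite IH cat_rcons andbA.
Qed.

Section generation_sums.
Variable V : nmodType.
Implicit Type F : vertex -> V.

Lemma sum_generationS K k F :
  \sum_(v <- generation K k.+1) F v =
  \sum_(v <- generation K k) \sum_(0 <= i < K v) F (rcons v i).
Proof.
rewrite /= big_flatten/= big_map; apply: eq_bigr => v _.
by rewrite big_map /index_iota subn0.
Qed.

(** [generation] extends words at the end, whereas the correlation recursion removes the first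
    letter, that is, it passes to a subtree of the root. *)
Lemma sum_words_cons n k F :
  \sum_(v <- words n k.+1) F v =
  \sum_(0 <= i < n) \sum_(u <- words n k) F (i :: u).
Proof.
elim: k F => [|k IH] F.
  rewrite sum_generationS big_seq1.
  by apply: eq_bigr => i _; rewrite big_seq1.
rewrite sum_generationS [LHS]IH; apply: eq_bigr => i _.
by rewrite [RHS]sum_generationS.
Qed.

(** A child i survives the cut iff both i < n and i < K v; the first condition is carried by the
    fixed index list and the second by the indicator. *)
Lemma sum_truncated_generation K n k F :
  \sum_(v <- generation (fun v => minn (K v) n) k) F v =
  \sum_(u <- words n k) F u *+ intree K [::] u.
Proof.
elim: k F => [|k IH] F; first by rewrite !big_seq1.
rewrite !sum_generationS IH; apply: eq_bigr => v _.
under [RHS]eq_bigr do rewrite intree_rcons -mulnb mulnC mulrnA.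
rewrite sumrMnl; congr (_ *+ _).
rewrite [RHS](big_cat_nat (n := minn (K v) n)) ?geq_minr//= [X in _ + X]big1_seq ?addr0.
  apply: eq_big_nat => i /andP[_]; rewrite leq_min => /andP[-> _].
  by rewrite mulr1n.
move=> i; rewrite mem_index_iota geq_min ltnNge => /andP[_ /andP[Ki ni]].
by rewrite (negbTE ni) orbF in Ki; rewrite ltnNge Ki.
Qed.

End generation_sums.

(** Finitely many offspring numbers determine a generation, so one cut-off exceeds them all.
    Truncated sums are therefore eventually constant at each sample point, which gives the pointwise
    limit for Fatou's lemma. *)
Lemma truncated_generation_eq K k : exists N, forall n, (N <= n)%N ->
  generation (fun v => minn (K v) n) k = generation K k.
Proof.
elim: k => [|k [N IH]]; first by exists 0%N.
exists (maxn N (\max_(v <- generation K k) K v)) => n.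
rewrite geq_max => /andP[Nn Mn] /=; rewrite IH//; congr flatten.
apply/eq_in_map => v vk; suff -> : minn (K v) n = K v by [].
by apply/minn_idPl; rewrite (leq_trans _ Mn)//; exact: leq_bigmax_seq.
Qed.

(** * The label correlations on the truncated tree *)

Section label_correlation.
Variables (R : realType) (p : nat -> R) (gamma Delta : R).
Hypothesis p0 : forall i, 0 <= p i.
Hypothesis gamma0 : 0 <= gamma.

(** This is E[1_{u in T} y_o y_u] when [p i] is the probability that a vertex has a child number i:
    each edge contributes its existence and one label correlation gamma. *)
Definition path_weight (u : vertex) : R := \prod_(i <- u) (gamma * p i).

(* E[1_{u in T} 1_{v in T} y_u y_v], as a recursion at the root: the two paths
   either share their first edge, or use independent subtrees of the root. *)
Fixpoint pair_weight (u v : vertex) : R :=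
  match u, v with
  | [::], _ => path_weight v
  | _, [::] => path_weight u
  | i :: u', j :: v' =>
      if i == j then p i * pair_weight u' v'
      else p (maxn i j) * (gamma * path_weight u') * (gamma * path_weight v')
  end.

Lemma path_weight_ge0 u : 0 <= path_weight u.
Proof. by apply: prodr_ge0 => i _; exact: mulr_ge0. Qed.

Lemma pair_weight_ge0 u v : 0 <= pair_weight u v.
Proof.
elim: u v => [|i u IH] [|j v]; rewrite ?path_weight_ge0//=.
have := path_weight_ge0; case: eqP => _ w0; rewrite !mulr_ge0//.
Qed.

Lemma pair_weightC u v : pair_weight u v = pair_weight v u.
Proof.
elim: u v => [|i u IH] [|j v] //=.
rewrite eq_sym maxnC; case: eqP => [->|_]; first by rewrite IH.
by rewrite mulrAC.
Qed.

Definition pair_sum n k m : R :=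
  \sum_(u <- words n k) \sum_(v <- words n m) pair_weight u v.

Variable n : nat.
(** For [p i] = P(K > i), the two left-hand sides below are the mean and the second factorial moment
    of min(K, n). *)
Hypothesis sum_p : \sum_(0 <= i < n) p i <= Delta.
Hypothesis sum_pp :
  \sum_(0 <= i < n) \sum_(0 <= j < n | j != i) p (maxn i j) <= Delta ^+ 2.
Let kappa := gamma ^+ 2 * Delta.
Hypothesis kappa1 : kappa <= 1.

Let Delta0 : 0 <= Delta.
Proof. by apply: le_trans sum_p; exact: sumr_ge0. Qed.

Lemma sum_path_weight k :
  0 <= \sum_(u <- words n k) path_weight u <= (gamma * Delta) ^+ k.
Proof.
rewrite sumr_ge0/=; last by move=> *; exact: path_weight_ge0.
elim: k => [|k IH]; first by rewrite big_seq1 /path_weight big_nil.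
rewrite sum_words_cons.
under eq_bigr do under eq_bigr do rewrite /path_weight big_cons -/(path_weight _).
under eq_bigr do rewrite -big_distrr/=.
rewrite -big_distrl/= -big_distrr/= exprS ler_pM//.
- by rewrite mulr_ge0// sumr_ge0.
- by rewrite sumr_ge0// => *; exact: path_weight_ge0.
- by rewrite ler_wpM2l.
Qed.

Lemma pair_sumC k m : pair_sum n k m = pair_sum n m k.
Proof.
rewrite /pair_sum exchange_big/=; apply: eq_bigr => u _.
by apply: eq_bigr => v _; rewrite pair_weightC.
Qed.

Lemma pair_sum0 m : pair_sum n 0 m <= (gamma * Delta) ^+ m.
Proof. by rewrite /pair_sum big_seq1; have /andP[_] := sum_path_weight m. Qed.

Lemma pair_sum_ge0 k m : 0 <= pair_sum n k m.
Proof. by apply: sumr_ge0 => u _; apply: sumr_ge0 => v _; exact: pair_weight_ge0. Qed.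

(** Split by first letters. Equal letters lead to the same problem in the subtree of one child, with
    at most Delta children on average; distinct letters give two separate paths, and at most Delta^2
    ordered pairs of children on average. *)
Lemma pair_sumSS k m : pair_sum n k.+1 m.+1 <=
  Delta * pair_sum n k m + gamma ^+ 2 * Delta ^+ 2 * (gamma * Delta) ^+ (k + m).
Proof.
pose S k := \sum_(u <- words n k) path_weight u.
have E : pair_sum n k.+1 m.+1 = (\sum_(0 <= i < n) p i) * pair_sum n k m +
    gamma ^+ 2 * (\sum_(0 <= i < n) \sum_(0 <= j < n | j != i) p (maxn i j)) *
    (S k * S m).
  rewrite /pair_sum sum_words_cons big_distrl big_distrr big_distrl -big_split/=.
  apply: eq_big_nat => i /andP[_ ni].
  under eq_bigr do rewrite sum_words_cons/=.
  rewrite exchange_big/= (bigD1_seq i) ?mem_index_iota ?iota_uniq//=.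
  rewrite eqxx; congr (_ + _).
    rewrite big_distrr; apply: eq_bigr => u _.
    by rewrite big_distrr.
  rewrite big_distrr big_distrl; apply: eq_bigr => j ji.
  rewrite eq_sym (negbTE ji) /S big_distrl big_distrr/=.
  apply: eq_bigr => u _; rewrite !big_distrr/=; apply: eq_bigr => v _.
  by rewrite expr2; ring.
rewrite E lerD//.
  by rewrite ler_wpM2r// pair_sum_ge0.
have /andP[Sk0 Sk] := sum_path_weight k.
have /andP[Sm0 Sm] := sum_path_weight m.
rewrite exprD ler_pM//.
- by rewrite mulr_ge0 ?exprn_ge0// sumr_ge0// => i _; rewrite sumr_ge0.
- by rewrite mulr_ge0.
- by rewrite ler_wpM2l ?exprn_ge0.
- exact: ler_pM.
Qed.

(** The right-hand side is (1 - kappa) times the sum of kappa^(k+m-j) over the depths j <= min(k,m)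
    of the last common ancestor. This closed form satisfies the recursion of [pair_sumSS] with
    equality, so simultaneous induction on k and m closes. *)
Lemma pair_sum_le k m : (1 - kappa) * (gamma ^+ (k + m) * pair_sum n k m) <=
  kappa ^+ maxn k m - kappa ^+ (k + m).+1.
Proof.
have base q : (1 - kappa) * (gamma ^+ q * pair_sum n 0 q) <=
    kappa ^+ q - kappa ^+ q.+1.
  rewrite exprS -{1}[kappa ^+ q]mul1r -mulrBl ler_wpM2l ?subr_ge0//.
  apply: (le_trans (ler_wpM2l (exprn_ge0 _ gamma0) (pair_sum0 q))).
  by rewrite -exprMn mulrA -expr2.
elim: k m => [|k IH] m; first by rewrite max0n; exact: base.
case: m => [|m]; first by rewrite maxn0 addn0 pair_sumC; exact: base.
apply: le_trans (_ : (1 - kappa) * (gamma ^+ (k.+1 + m.+1) *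
   (Delta * pair_sum n k m +
    gamma ^+ 2 * Delta ^+ 2 * (gamma * Delta) ^+ (k + m))) <= _).
  by rewrite ler_wpM2l ?subr_ge0// ler_wpM2l ?exprn_ge0// pair_sumSS.
have -> : (1 - kappa) * (gamma ^+ (k.+1 + m.+1) *
   (Delta * pair_sum n k m +
    gamma ^+ 2 * Delta ^+ 2 * (gamma * Delta) ^+ (k + m))) =
  kappa * ((1 - kappa) * (gamma ^+ (k + m) * pair_sum n k m)) +
  (1 - kappa) * kappa ^+ (k + m).+2.
  have -> : kappa ^+ (k + m).+2 =
      kappa ^+ 2 * (gamma ^+ (k + m) * (gamma * Delta) ^+ (k + m)).
    by rewrite -exprMn mulrA -expr2 -exprD add2n.
  by rewrite addSn addnS 2!exprS /kappa; ring.
have -> : kappa ^+ maxn k.+1 m.+1 - kappa ^+ (k.+1 + m.+1).+1 =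
    kappa * (kappa ^+ maxn k m - kappa ^+ (k + m).+1) +
    (1 - kappa) * kappa ^+ (k + m).+2.
  by rewrite maxnSS addSn addnS !exprS; ring.
by rewrite lerD2r ler_wpM2l// mulr_ge0 ?exprn_ge0.
Qed.

End label_correlation.

(** The maximum equals n for 2n+1 pairs, and the series of (2n+1) x^n sums to (1+x)/(1-x)^2 when x <
    1. The proof finds the finite remainder exactly and drops it as nonnegative. *)
Lemma sum_expr_max (R : realFieldType) (x : R) (N : nat) : 0 <= x <= 1 ->
  (1 - x) ^+ 2 * (\sum_(k < N) \sum_(m < N) x ^+ maxn k m) <= 1 + x.
Proof.
move=> /andP[x0 x1].
suff -> : (1 - x) ^+ 2 * (\sum_(k < N) \sum_(m < N) x ^+ maxn k m) =
    1 + x - x ^+ N * ((1 - x) * N.*2%:R + (1 + x)).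
  rewrite gerBl mulr_ge0 ?exprn_ge0// addr_ge0 ?mulr_ge0 ?subr_ge0//.
  exact: addr_ge0.
elim: N => [|N IH]; first by rewrite big_ord0 expr0 double0; ring.
rewrite big_ord_recr/=.
have -> : \sum_(m < N.+1) x ^+ maxn N m = x ^+ N *+ N.+1.
  rewrite (eq_bigr (fun=> x ^+ N)) ?sumr_const ?card_ord// => m _.
  by rewrite (maxn_idPl _)// -ltnS.
under eq_bigr do rewrite big_ord_recr/=.
rewrite big_split/= mulrDr mulrDr IH.
have -> : \sum_(i < N) x ^+ maxn i N = x ^+ N *+ N.
  rewrite (eq_bigr (fun=> x ^+ N)) ?sumr_const ?card_ord// => m _.
  by rewrite (maxn_idPr _)// ltnW.
rewrite mulrSr -[x ^+ N *+ N]mulr_natl -!mul2n !natrM -[N.+1%:R]natr1.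
rewrite [x ^+ N.+1]exprS.
by move: (x ^+ N) N%:R => z t; ring.
Qed.

(** * Moments of the truncated Poisson law *)

Lemma sum_ltn_le n k : (\sum_(0 <= i < n) (i < k) <= k)%N.
Proof.
suff -> : (\sum_(0 <= i < n) (i < k) = minn n k)%N by exact: geq_minr.
elim: n => [|n IH]; first by rewrite big_nil min0n.
rewrite big_nat_recr//= IH; case: ltnP => nk.
  by rewrite (minn_idPl nk) addn1.
by rewrite (minn_idPr (leqW nk)) addn0.
Qed.

Section poisson_tail.
Variables (R : realType) (Delta : R).
Hypothesis Delta0 : 0 < Delta.
Let q := poisson_pmf Delta.

(** P(K > t), the probability that child number t exists, children being numbered from 0. Taking the
    complement keeps the sum finite. *)
Definition poisson_tail (t : nat) : R := 1 - \sum_(k < t.+1) poisson_pmf Delta k.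

Let poisson_pmfS k : k.+1%:R * q k.+1 = Delta * q k.
Proof.
rewrite /q /poisson_pmf Delta0 exprS factS natrM invfM.
have k0 : k.+1%:R != 0 :> R by rewrite pnatr_eq0.
move: k.+1%:R k0 (Delta ^+ k) k`!%:R^-1 (expR _) => n n0 u v w.
by rewrite -[RHS]mul1r -(divff n0); ring.
Qed.

Let series_poisson_pmf : (\sum_(k < N) q k) @[N --> \oo] --> (1 : R).
Proof.
have -> : (fun N => \sum_(k < N) q k) =
    (fun N => series (exp_coeff Delta) N * expR (- Delta)).
  apply/funext => N; rewrite /series/= big_mkord mulr_suml.
  by apply: eq_bigr => k _; rewrite /q /poisson_pmf Delta0.
rewrite -(expR0 R) -(addrN Delta) expRD; apply: cvgMl.
exact: is_cvg_series_exp_coeff.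
Qed.

Lemma poisson_tail_ge0 t : 0 <= poisson_tail t.
Proof.
rewrite subr_ge0 -(cvg_lim _ series_poisson_pmf)//.
apply: (nondecreasing_cvgn_le (u_ := fun N => \sum_(k < N) q k)).
  apply/nondecreasing_seqP => N.
  by rewrite big_ord_recr/= lerDl poisson_pmf_ge0.
by apply/cvg_ex; exists 1.
Qed.

Lemma cvg_poisson_tail : poisson_tail t @[t --> \oo] --> (0 : R).
Proof.
rewrite -(subrr 1); apply: cvgB; first exact: cvg_cst.
by have := series_poisson_pmf; rewrite -(cvg_shiftS (fun N => \sum_(k < N) q k)).
Qed.

(** A sum of tails is the expected number of i with t_i < K. It suffices to bound the partial sums
    of this expectation over the values of K. *)
Lemma sum_poisson_tail_le (I : eqType) (r : seq I) (Q : pred I) (t : I -> nat)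
    (b : R) :
  (forall N, \sum_(k < N) q k * \sum_(i <- r | Q i) (t i < k)%:R <= b) ->
  \sum_(i <- r | Q i) poisson_tail (t i) <= b.
Proof.
move=> tb; pose c : R := \sum_(i <- r | Q i) 1.
pose M := \max_(i <- r | Q i) t i.
(* Once N is at least every t_i, each tail is its part over k <= N plus the tail at N; the latter,
   counted [c] times, vanishes in the limit. *)
have H N : (M <= N)%N ->
    \sum_(i <- r | Q i) poisson_tail (t i) <= b + c * poisson_tail N.
  move=> MN; rewrite (le_trans _ (lerD (tb N.+1) (lexx _)))//.
  under [X in X + _]eq_bigr do rewrite mulr_sumr.
  rewrite exchange_big/= /c mulr_suml -big_split/= big_seq_cond [leRHS]big_seq_cond.
  apply: ler_sum => i /andP[ir Qi]; rewrite mul1r.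
  have tiN : (t i <= N)%N.
    by rewrite (leq_trans _ MN)//; exact: leq_bigmax_seq.
  rewrite /poisson_tail [leRHS]addrCA lerD2l.
  have E1 : \sum_(k < N.+1) q k = \sum_(k < (t i).+1) q k +
      \sum_((t i).+1 <= k < N.+1) q k.
    rewrite -(big_mkord xpredT q) -(big_mkord xpredT q).
    by rewrite (big_cat_nat (n := (t i).+1)).
  have E2 : \sum_(k < N.+1) q k * (t i < k)%:R =
      \sum_((t i).+1 <= k < N.+1) q k.
    rewrite -(big_mkord xpredT (fun k => q k * (t i < k)%:R)).
    rewrite (big_cat_nat (n := (t i).+1))//= big1_seq ?add0r.
      by apply: eq_big_nat => k /andP[kt _]; rewrite kt mulr1.
    by move=> k /=; rewrite mem_index_iota ltnS => /andP[_ kt]; rewrite ltnNge kt mulr0.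
  by rewrite E2 E1 opprD addrCA subrr addr0.
have cv : (b + c * poisson_tail N) @[N --> \oo] --> b.
  rewrite -[X in _ --> X]addr0 -(mulr0 c); apply: cvgD; first exact: cvg_cst.
  by apply: cvgMr; exact: cvg_poisson_tail.
rewrite -(cvg_lim _ cv)//; apply: limr_ge; first by apply/cvg_ex; exists b.
by near=> N; apply: H; near: N; exact: nbhs_infty_ge.
Unshelve. all: by end_near. Qed.

Lemma sum_poisson_pmf_le1 N : \sum_(k < N) q k <= 1.
Proof.
case: N => [|N]; first by rewrite big_ord0.
by have := poisson_tail_ge0 N; rewrite subr_ge0.
Qed.

Lemma sum_poisson_mean N : \sum_(k < N) q k * k%:R <= Delta.
Proof.
case: N => [|N]; first by rewrite big_ord0 ltW.
rewrite big_ord_recl mulr0 add0r.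
under eq_bigr do rewrite mulrC poisson_pmfS.
by rewrite -mulr_sumr ler_piMr ?(ltW Delta0)// sum_poisson_pmf_le1.
Qed.

Lemma sum_poisson_factorial_moment N :
  \sum_(k < N) q k * (k * k.-1)%:R <= Delta ^+ 2.
Proof.
case: N => [|N]; first by rewrite big_ord0 exprn_ge0// ltW.
rewrite big_ord_recl mulr0 add0r.
under eq_bigr do rewrite natrM mulrA [q _ * _]mulrC poisson_pmfS -mulrA.
by rewrite -mulr_sumr expr2 ler_wpM2l ?(ltW Delta0)// sum_poisson_mean.
Qed.

Lemma sum_poisson_tail n : \sum_(0 <= i < n) poisson_tail i <= Delta.
Proof.
apply: sum_poisson_tail_le => N; apply: le_trans (sum_poisson_mean N).
apply: ler_sum => k _; rewrite ler_wpM2l ?poisson_pmf_ge0// -natr_sum ler_nat.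
exact: sum_ltn_le.
Qed.

(** max(i,j) < k means that both i and j are below k, and there are at most k(k-1) ordered pairs of
    distinct such indices; this brings in the factorial moment Delta^2. *)
Lemma sum_poisson_tail2 n :
  \sum_(0 <= i < n) \sum_(0 <= j < n | j != i) poisson_tail (maxn i j) <=
  Delta ^+ 2.
Proof.
under eq_bigr do rewrite big_mkord.
rewrite big_mkord pair_big_dep/=.
apply: sum_poisson_tail_le => N.
apply: le_trans (sum_poisson_factorial_moment N).
apply: ler_sum => k _; rewrite ler_wpM2l ?poisson_pmf_ge0// -natr_sum ler_nat.
rewrite -(pair_big_dep xpredT (fun i j : 'I_n => j != i :> nat)
  (fun i j : 'I_n => (maxn i j < k)%N : nat))/=.
apply: leq_trans (_ : \sum_(i < n) (i < k) * k.-1 <= _)%N.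
  apply: leq_sum => i _; case: (ltnP i k) => ik; last first.
    rewrite mul0n big1// => j _; rewrite gtn_max ltnNge ik //.
  rewrite mul1n -ltnS (ltn_predK ik).
  apply: leq_trans (sum_ltn_le n k); rewrite big_mkord [ltnRHS](bigD1 i)//= ik add1n ltnS.
  by apply: leq_sum => j _; rewrite gtn_max ik.
rewrite -big_distrl leq_mul2r -(big_mkord xpredT (fun i => (i < k)%N : nat)).
by rewrite sum_ltn_le orbT.
Qed.

End poisson_tail.

(** * Tree and label variables as products of independent factors *)

Section tree_factors.
Context (R : realType) (Omega : Type).
Variables (K : vertex -> Omega -> nat) (y : vertex -> Omega -> bool).

(* A pair (inl v, t) stands for the factor 1[t < K_v], and (inr v, _) for the
   sign of the innovation at v. *)
Definition tree_factor (j : (vertex + vertex) * nat) (w : Omega) : R :=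
  match j.1 with
  | inl v => (j.2 < K v w)%:R
  | inr v => sgl R (innovation y v w)
  end.

(** Existence and sign factors along the path from [w] to [w ++ u]. The second component of a sign
    entry is a dummy 0. *)
Fixpoint path_factors (w u : vertex) : seq ((vertex + vertex) * nat) :=
  if u is i :: u' then
    [:: (inl w, i), (inr (rcons w i), 0%N) & path_factors (rcons w i) u']
  else [::].

(** Concatenating two path lists would repeat variables. On a shared edge the sign squares to 1 and
    the existence factor is idempotent; where the paths split, i < K and j < K merge into max(i,j) <
    K. What remains uses each variable once. *)
Fixpoint pair_factors (w u v : vertex) : seq ((vertex + vertex) * nat) :=
  match u, v with
  | [::], _ => path_factors w v
  | _, [::] => path_factors w u
  | i :: u', j :: v' =>
      if i == j then (inl w, i) :: pair_factors (rcons w i) u' v'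
      else [:: (inl w, maxn i j), (inr (rcons w i), 0%N), (inr (rcons w j), 0%N) &
            path_factors (rcons w i) u' ++ path_factors (rcons w j) v']
  end.

Lemma innovation_rcons v i w :
  innovation y (rcons v i) w = (y (rcons v i) w == y v w).
Proof.
have -> : innovation y (rcons v i) w =
    (y (rcons v i) w == y (parent (rcons v i)) w) by case: v.
by rewrite /parent size_rcons/= -cats1 take_size_cat.
Qed.

(** The label at the end of a path is the label at its start times the innovation signs along it. *)
Lemma intree_label_factors w u x :
  (intree (fun v => K v x) w u)%:R * sgl R (y (w ++ u) x) =
  sgl R (y w x) * \prod_(j <- path_factors w u) tree_factor j x.
Proof.
elim: u w => [|i u IH] w /=; first by rewrite cats0 big_nil mul1r mulr1.
rewrite -mulnb natrM -cat_rcons -mulrA IH !big_cons {2}/tree_factor {2}/tree_factor/=.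
rewrite innovation_rcons; set b := (_ < _)%:R; set z := \prod_(_ <- _) _.
have -> : sgl R (y (rcons w i) x) =
    sgl R (y w x) * sgl R (y (rcons w i) x == y w x).
  by rewrite /sgl; case: (y (rcons w i) x); case: (y w x);
    rewrite /= ?mulr1 ?mul1r ?mulrNN ?mulr1.
by ring.
Qed.

Lemma prod_pair_factors w u v x :
  (\prod_(j <- path_factors w u) tree_factor j x) *
  (\prod_(j <- path_factors w v) tree_factor j x) =
  \prod_(j <- pair_factors w u v) tree_factor j x.
Proof.
have sgl2 b : sgl R b * sgl R b = 1.
  by rewrite /sgl; case: b; rewrite ?mulrNN mulr1.
elim: u w v => [|i u IH] w [|j v] //=; rewrite ?big_nil ?mul1r ?mulr1//.
rewrite !big_cons; case: eqP => [<-|_]; rewrite !big_cons.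
  rewrite -IH /tree_factor/=.
  set a := (_ < _)%:R; set s := sgl _ _.
  have aa : a * a = a by rewrite /a -natrM mulnb andbb.
  transitivity ((a * a) * (s * s) * ((\prod_(j <- path_factors (rcons w i) u)
     tree_factor j x) * (\prod_(j <- path_factors (rcons w i) v) tree_factor j x))).
    by rewrite /tree_factor; ring.
  by rewrite sgl2 aa mulr1.
rewrite big_cat/= /tree_factor/= gtn_max -mulnb natrM; ring.
Qed.

(** The variables that paths starting at [w] may use: the offspring number of [w] counts, but its
    innovation belongs to the edge above it. *)
Definition below (w : vertex) (x : vertex + vertex) : bool :=
  match x with inl v => prefix w v | inr v => prefix w v && (v != w) end.

(** The letter at position [size w] tells the child subtrees of [w] apart; two different children
    thus share no variable. *)
Lemma below_rcons w i x : below (rcons w i) x ->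
  let v := match x with inl v | inr v => v end in
  [/\ below w x, (size w < size v)%N & nth 0%N v (size w) = i].
Proof.
have H v : prefix (rcons w i) v -> [/\ prefix w v, v != w, (size w < size v)%N &
    nth 0%N v (size w) = i].
  move=> /prefixP[t ->]; rewrite cat_rcons prefix_prefix size_cat/=.
  rewrite -[X in (X < _)%N]addn0 ltn_add2l nth_cat ltnn subnn; split => //.
  by rewrite -{2}[w]cats0 eqseq_cat// eqxx.
by case: x => v /=; [move=> /H[]|move=> /andP[/H[-> -> *]]].
Qed.

Lemma path_factors_below w u x : x \in map fst (path_factors w u) -> below w x.
Proof.
elim: u w => [|i u IH] w //=; rewrite !inE => /or3P[/eqP ->|/eqP ->|/IH].
- exact: prefix_refl.
- by rewrite /= prefix_rcons -cats1 -{2}[w]cats0 eqseq_cat// eqxx.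
- by move=> /below_rcons[].
Qed.

Lemma path_factors_uniq w u : uniq (map fst (path_factors w u)).
Proof.
elim: u w => [|i u IH] w //=; rewrite IH andbT inE negb_or/=.
apply/andP; split; apply/negP => /path_factors_below/=.
- by move/size_prefix; rewrite size_rcons ltnn.
- by rewrite eqxx andbF.
Qed.

Lemma pair_factors_below w u v x :
  x \in map fst (pair_factors w u v) -> below w x.
Proof.
elim: u w v => [|i u IH] w [|j v]; [by []|exact: path_factors_below|
  exact: path_factors_below|].
have wi k : prefix w (rcons w k) && (rcons w k != w).
  by rewrite prefix_rcons -cats1 -{2}[w]cats0 eqseq_cat// eqxx.
rewrite /=; case: eqP => _; rewrite /= !inE.
  by move=> /predU1P[->|/IH /below_rcons[]//]; exact: prefix_refl.
move=> /or4P[/eqP ->|/eqP ->|/eqP ->|]; rewrite /= ?prefix_refl//.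
by rewrite map_cat mem_cat => /orP[] /path_factors_below /below_rcons[].
Qed.

(** This is the distinctness of keys required by [independent_factors]. *)
Lemma pair_factors_uniq w u v : uniq (map fst (pair_factors w u v)).
Proof.
elim: u w v => [|i u IH] w [|j v]; [by []|exact: path_factors_uniq|
  exact: path_factors_uniq|].
rewrite /=; case: eqP => [_|ij] /=.
  rewrite IH andbT; apply/negP => /pair_factors_below/=.
  by move/size_prefix; rewrite size_rcons ltnn.
rewrite map_cat cat_uniq !path_factors_uniq andbT/= !inE !negb_or !mem_cat !negb_or.
have nth_rcons k : nth 0%N (rcons w k) (size w) = k.
  by rewrite nth_rcons ltnn eqxx.
have out k z (x : vertex + vertex) : let v := match x with inl v | inr v => v end in
    nth 0%N v (size w) != k -> x \notin map fst (path_factors (rcons w k) z).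
  move=> v' vk; apply/negP => /path_factors_below /below_rcons[_ _].
  by move/eqP; apply/negP.
have ownl k z : inl w \notin map fst (path_factors (rcons w k) z).
  by apply/negP => /path_factors_below /below_rcons[_]; rewrite ltnn.
have ownr k z : inr (rcons w k) \notin map fst (path_factors (rcons w k) z).
  by apply/negP => /path_factors_below /=; rewrite eqxx andbF.
rewrite !ownl !ownr !out/= ?nth_rcons//; try by apply/eqP => // /esym.
rewrite andbT; apply/andP; split.
  by apply/eqP => -[] /(congr1 (nth 0%N ^~ (size w))); rewrite !nth_rcons.
apply/hasPn => x /path_factors_below /below_rcons[_ _ xj].
by apply: out; rewrite xj; apply/eqP => /esym.
Qed.

End tree_factors.

(** * Label correlations as expectations on the limit object *)

Section label_expectation.
Context (R : realType) (d : nat) (dO : measure_display)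
  (Omega : measurableType dO) (P : probability Omega R) (Delta gamma : R)
  (Pp Pm : probability (d.-tuple R) R)
  (K : vertex -> {RV P >-> nat}) (y : vertex -> {RV P >-> bool})
  (X : vertex -> {RV P >-> d.-tuple R}).
Hypothesis limit_object : is_limit_object Delta gamma Pp Pm K y X.

Let F (i : vertex + vertex) : set (set Omega) :=
  match i with
  | inl v => g_sigma_algebra_preimage (K v)
  | inr v => g_sigma_algebra_preimage (innovation y v)
  end.

Lemma measurable_offspring v (B : set nat) : measurable (K v @^-1` B).
Proof. by rewrite -[_ @^-1` _]setTI; exact: measurable_funPT. Qed.

Lemma measurable_label v (B : set bool) : measurable (y v @^-1` B).
Proof. by rewrite -[_ @^-1` _]setTI; exact: measurable_funPT. Qed.

Lemma measurable_innovation v : measurable_fun setT (innovation y v).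
Proof.
have [->|[w [i ->]]] : v = [::] \/ exists w i, v = rcons w i.
  by case/lastP: v => [|w i]; [left|right; exists w, i].
  exact: measurable_funPT.
apply: (measurable_fun_bool true).
rewrite setTI (_ : _ @^-1` _ =
  (y (rcons w i) @^-1` [set true] `&` y w @^-1` [set true]) `|`
  (y (rcons w i) @^-1` [set false] `&` y w @^-1` [set false])).
  by apply: measurableU; apply: measurableI; exact: measurable_label.
apply/seteqP; split => x; rewrite /= innovation_rcons.
  by move/eqP ->; case: (y w x); [left|right].
by move=> [] [-> ->].
Qed.

Let F_measurable i : F i `<=` measurable.
Proof.
case: i => v _ [B mB <-]; first exact: measurable_funPT.
exact: measurable_innovation.
Qed.

Let factor_indic j : exists A B (a b : R), [/\ F j.1 A, F j.1 B &
  tree_factor R K y j = fun x => a * \1_A x + b * \1_B x].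
Proof.
case: j => -[v t|v t].
  exists (K v @^-1` [set k | (t < k)%N]), set0, 1, 0; split.
  - by exists [set k | (t < k)%N]; rewrite ?setTI.
  - by exists set0; rewrite ?preimage_set0 ?setI0.
  - apply/funext => x; rewrite /tree_factor/= mul1r mul0r addr0 indicE.
    have [tK|Kt] := boolP (t < K v x)%N; first by rewrite mem_set.
    by rewrite memNset//=; exact/negP.
exists (innovation y v @^-1` [set true]), (innovation y v @^-1` [set false]), 1, (-1).
split.
- by exists [set true]; rewrite ?setTI.
- by exists [set false]; rewrite ?setTI.
- apply/funext => x; rewrite /tree_factor/= !indicE /sgl.
  case: (boolP (innovation y v x)) => [e|/negbTE e].
    by rewrite mem_set//= memNset/= ?e// mulr0 addr0 mulr1.
  by rewrite memNset/= ?e// mem_set//= mulr0 add0r mulr1.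
Qed.

Let expectation_offspring_factor v t :
  \int[P]_w tree_factor R K y (inl v, t) w = poisson_tail Delta t.
Proof.
have bK k : bounded_mfun (\1_(K v @^-1` [set k]) : Omega -> R).
  exact/bounded_mfun_indic/measurable_offspring.
transitivity (\int[P]_w (1 + -1 * \sum_(k < t.+1) \1_(K v @^-1` [set val k]) w)).
  apply: eq_Rintegral => x _; rewrite /tree_factor/=.
  case: (ltnP t (K v x)) => [tK|Kt].
    rewrite big1 ?mulr0 ?addr0// => k _; rewrite indicE memNset//= => Kk.
    by have := ltn_ord k; rewrite -Kk ltnNge tK.
  rewrite (bigD1 (Ordinal (Kt : (K v x < t.+1)%N)))//= indicE mem_set//.
  rewrite big1 ?addr0 ?mulr1 ?subrr// => k /eqP kK; rewrite indicE memNset//= => Kk.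
  by apply: kK; apply: val_inj; rewrite /= Kk.
rewrite Rintegral_bounded_mfunD; first last.
- by apply: bounded_mfunM; [exact: bounded_mfun_cst|exact: bounded_mfun_sum].
- exact: bounded_mfun_cst.
rewrite Rintegral_bounded_mfunZ ?Rintegral_bounded_mfun_sum//; last first.
  exact: bounded_mfun_sum.
rewrite Rintegral_probability_cst mulN1r; congr (1 - _); apply: eq_bigr => k _.
rewrite Rintegral_indic; last exact: measurable_offspring.
by rewrite (offspring_poisson limit_object).
Qed.

Let expectation_innovation_factor v i t :
  \int[P]_w tree_factor R K y (inr (rcons v i), t) w = gamma.
Proof.
pose A := [set w | y (rcons v i) w = y v w].
have mA : measurable A.
  rewrite (_ : A = innovation y (rcons v i) @^-1` [set true]).
    by rewrite -[_ @^-1` _]setTI; exact: measurable_innovation.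
  by apply/seteqP; split => x /=; rewrite innovation_rcons => /eqP.
transitivity (\int[P]_w (-1 + 2 * \1_A w)).
  apply: eq_Rintegral => x _; rewrite /tree_factor/= innovation_rcons indicE /sgl.
  case: eqP => e; first by rewrite mem_set// mulr1; lra.
  by rewrite memNset// mulr0; lra.
have bA : bounded_mfun (\1_A : Omega -> R) by exact: bounded_mfun_indic.
rewrite Rintegral_bounded_mfunD; first last.
- by apply: bounded_mfunM; [exact: bounded_mfun_cst|].
- exact: bounded_mfun_cst.
rewrite Rintegral_bounded_mfunZ// Rintegral_probability_cst Rintegral_indic//.
by rewrite (child_label_agrees limit_object)/=; lra.
Qed.

Let prod_expectation_path w u :
  \prod_(j <- path_factors w u) \int[P]_x tree_factor R K y j x =
  path_weight (poisson_tail Delta) gamma u.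
Proof.
elim: u w => [|i u IH] w; rewrite /path_weight ?big_nil//= !big_cons.
rewrite expectation_offspring_factor expectation_innovation_factor IH.
by rewrite mulrA [gamma * _]mulrC.
Qed.

Let prod_expectation_pair w u v :
  \prod_(j <- pair_factors w u v) \int[P]_x tree_factor R K y j x =
  pair_weight (poisson_tail Delta) gamma u v.
Proof.
elim: u w v => [|i u IH] w [|j v]; [exact: (prod_expectation_path w [::])|
  exact: prod_expectation_path|exact: prod_expectation_path|] => /=.
case: eqP => _; rewrite !big_cons expectation_offspring_factor ?IH//.
by rewrite !expectation_innovation_factor big_cat !prod_expectation_path/=; ring.
Qed.

Lemma expectation_label_pair u v :
  \int[P]_w ((intree (fun v => K v w) [::] u && intree (fun v => K v w) [::] v)%:R *
     (sgl R (y u w) * sgl R (y v w))) =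
  pair_weight (poisson_tail Delta) gamma u v.
Proof.
transitivity (\int[P]_w \prod_(j <- pair_factors [::] u v) tree_factor R K y j w).
  apply: eq_Rintegral => w _; rewrite -mulnb natrM mulrACA.
  have /= E z := @intree_label_factors R Omega (fun v => K v) (fun v => y v) [::] z w.
  (* Both labels contain the root label as a factor, and it squares to 1. *)
  rewrite !E mulrACA -prod_pair_factors.
  by rewrite /sgl; case: (y _ w); rewrite ?mulrNN !mul1r.
rewrite (@independent_factors _ _ _ _ _ F F_measurable
  (offspring_innovations_indep limit_object) _ _ fst)//.
exact: pair_factors_uniq.
Qed.

End label_expectation.

(** * Conditional independence of one feature from the rest *)

Section independent_integral.
Context (d1 d2 dO : measure_display) (T1 : measurableType d1)
  (T2 : measurableType d2) (Omega : measurableType dO) (R : realType).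
Local Open Scope ereal_scope.

Lemma ge0_integral_mrestr (P : {measure set Omega -> \bar R}) (E : set Omega)
    (mE : measurable E) (f : Omega -> \bar R) :
  measurable_fun setT f -> (forall x, 0 <= f x) ->
  \int[mrestr P mE]_w f w = \int[P]_(w in E) f w.
Proof.
have mEC := measurableC mE => mf f0.
have E0 : mrestr P mE (~` E) = 0 by rewrite /mrestr setICl measure0.
transitivity (\int[mrestr P mE]_(w in setT `\` ~` E) f w).
  exact: ge0_negligible_integral.
rewrite setTD setCK; apply: eq_measure_integral => A mA AE.
by rewrite /= /mrestr setIidl.
Qed.

(** Under P restricted to E, the joint law of (f, g) is the product of Q and the law of g, since the
    two agree on rectangles. Tonelli's theorem then integrates f out. *)
Lemma independent_integral (P : probability Omega R) (E : set Omega)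
    (Q : probability T1 R) (f : Omega -> T1) (g : Omega -> T2)
    (h : T1 * T2 -> \bar R) :
  measurable E -> measurable_fun setT f -> measurable_fun setT g ->
  (forall A B, measurable A -> measurable B ->
     P (E `&` (f @^-1` A `&` g @^-1` B)) = Q A * P (E `&` g @^-1` B)) ->
  measurable_fun setT h -> (forall z, 0 <= h z) ->
  \int[P]_(w in E) h (f w, g w) =
  \int[P]_(w in E) \int[Q]_x h (x, g w).
Proof.
move=> mE mf mg fg mh h0.
have mfg : measurable_fun setT (fun w => (f w, g w)).
  exact: measurable_fun_pair.
pose PE : {finite_measure set Omega -> \bar R} := mrestr P mE.
pose m : {measure set (T1 * T2) -> \bar R} := pushforward PE (fun w => (f w, g w)).
pose n : {measure set T2 -> \bar R} := pushforward PE g.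
have noo : n mg setT < +oo.
  by change (PE (g @^-1` setT) < +oo); rewrite preimage_setT ltey_eq fin_num_measure.
(* Restricting to the whole space changes nothing; it only packages the law of g as a finite
   measure. *)
pose Q2 : {finite_measure set T2 -> \bar R} := mfrestr measurableT noo.
have QQm X : measurable X -> (Q \x Q2) X = m mfg X.
  apply: product_measure_unique => A B mA mB.
  rewrite /m /= /pushforward /PE /= /mfrestr /mrestr /= /pushforward setIT.
  by rewrite setIC fg// [_ `&` E]setIC.
have mG : measurable_fun setT (fun y => \int[Q]_x h (x, y)).
  exact: measurable_fun_fubini_tonelli_G.
rewrite -(ge0_integral_mrestr P mE) //; last exact: (measurableT_comp mh mfg).
rewrite -(ge0_integral_mrestr P mE); first last.
- by move=> w; exact: integral_ge0.
- exact: (measurableT_comp mG mg).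
transitivity (\int[m mfg]_z h z); first by rewrite ge0_integral_pushforward.
transitivity (\int[Q \x Q2]_z h z).
  by apply: eq_measure_integral => A mA _; exact/esym/QQm.
rewrite fubini_tonelli2//.
transitivity (\int[n mg]_y \int[Q]_x h (x, y)).
  by apply: eq_measure_integral => A mA _; rewrite /Q2/= /mfrestr /mrestr/= setIT.
rewrite ge0_integral_pushforward//.
by move=> y _; exact: integral_ge0.
Qed.

End independent_integral.

Section feature_independence.
Context (R : realType) (d : nat) (dO : measure_display)
  (Omega : measurableType dO) (P : probability Omega R) (Delta gamma : R)
  (Pp Pm : probability (d.-tuple R) R)
  (K : vertex -> {RV P >-> nat}) (y : vertex -> {RV P >-> bool})
  (X : vertex -> {RV P >-> d.-tuple R}).

Definition tree_events : set (set Omega) :=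
  \bigcup_v (g_sigma_algebra_preimage (K v) `|` g_sigma_algebra_preimage (y v)).

(* A pi-system generating the sigma-algebra of the tree, the labels and all
   features but the one at [u]. *)
Definition rest_events (u : vertex) : set (set Omega) :=
  [set C | exists (E : set Omega) (J : {fset vertex})
      (A : vertex -> set (d.-tuple R)),
    [/\ <<s tree_events >> E, u \notin J, (forall v, measurable (A v)) &
        C = E `&` \bigcap_(v in [set` J]) (X v @^-1` A v)]].

Lemma tree_eventsT : <<s tree_events >> setT.
Proof. exact: (@measurableT _ (g_sigma_algebraType tree_events)). Qed.

Lemma tree_eventsI A B : <<s tree_events >> A -> <<s tree_events >> B ->
  <<s tree_events >> (A `&` B).
Proof. exact: (@measurableI _ (g_sigma_algebraType tree_events)). Qed.

Lemma tree_events_offspring v (B : set nat) : <<s tree_events >> (K v @^-1` B).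
Proof.
apply: sub_sigma_algebra; exists v => //; left.
by exists B => //; rewrite setTI.
Qed.

Lemma tree_events_label v (B : set bool) : <<s tree_events >> (y v @^-1` B).
Proof.
apply: sub_sigma_algebra; exists v => //; right.
by exists B => //; rewrite setTI.
Qed.

Lemma tree_events_measurable E : <<s tree_events >> E -> measurable E.
Proof.
apply: smallest_sub; first exact: sigma_algebra_measurable.
by move=> _ [v _ []] [B mB <-]; exact: measurable_funPT.
Qed.

Lemma measurable_feature v (A : set (d.-tuple R)) :
  measurable A -> measurable (X v @^-1` A).
Proof. by move=> mA; rewrite -[_ @^-1` _]setTI; exact: measurable_funPT. Qed.

Lemma rest_events_measurable u : rest_events u `<=` measurable.
Proof.
move=> _ [E [J [A [sE _ mA ->]]]]; apply: measurableI.
  exact: tree_events_measurable.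
by apply: fin_bigcap_measurable => // v _; exact: measurable_feature.
Qed.

Lemma rest_eventsT u : rest_events u setT.
Proof.
exists setT, fset0, (fun=> setT); split=> //; first exact: tree_eventsT.
by apply/esym/seteqP; split => //= w _; split => // v _.
Qed.

Lemma rest_events_tree u E : <<s tree_events >> E -> rest_events u E.
Proof.
move=> sE; exists E, fset0, (fun=> setT); split=> //.
by apply/seteqP; split => [w Ew|w []//]; split => // v _.
Qed.

Lemma rest_events_feature u v (A : set (d.-tuple R)) :
  u != v -> measurable A -> rest_events u (X v @^-1` A).
Proof.
move=> uv mA; exists setT, [fset v]%fset, (fun=> A); split=> //.
- exact: tree_eventsT.
- by rewrite inE.
- rewrite setTI; apply/seteqP; split => [w Aw z /=|w].
    by rewrite inE => /eqP ->.
  by apply; rewrite /= inE.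
Qed.

Lemma rest_events_setI u : setI_closed (rest_events u).
Proof.
move=> _ _ [E [J [A [sE uJ mA ->]]]] [E' [J' [A' [sE' uJ' mA' ->]]]].
exists (E `&` E'), (J `|` J')%fset, (fun v =>
  (if v \in J then A v else setT) `&` (if v \in J' then A' v else setT)).
split.
- exact: tree_eventsI.
- by rewrite inE negb_or uJ.
- by move=> v; apply: measurableI; case: ifP.
- rewrite setIACA; congr (_ `&` _); apply/seteqP; split => w /=.
    move=> [wA wA'] v _; split; case: ifP => // vJ; [exact: wA|exact: wA'].
  by move=> H; split => v /= vJ; have := H v; rewrite /= inE vJ ?orbT => /(_ isT) [? ?].
Qed.

Hypothesis limit_object : is_limit_object Delta gamma Pp Pm K y X.

Let Q (s : bool) := if s then Pp else Pm.

Local Open Scope ereal_scope.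

(** As functions of C both sides are finite measures, so agreement on the pi-system [rest_events u]
    is enough. *)
Lemma feature_independence u s A C : measurable A -> <<s rest_events u >> C ->
  P (y u @^-1` [set s] `&` (X u @^-1` A `&` C)) =
  Q s A * P (y u @^-1` [set s] `&` C).
Proof.
move=> mA sC.
have mys : measurable (y u @^-1` [set s]).
  by apply: tree_events_measurable; exact: tree_events_label.
have mXA := measurable_feature u mA.
have mXys : measurable (X u @^-1` A `&` y u @^-1` [set s]) by exact: measurableI.
have QA0 : (0 <= fine (Q s A))%R by apply: fine_ge0; exact: measure_ge0.
have QAE : (fine (Q s A))%:E = Q s A by rewrite fineK// fin_num_measure.
suff : mrestr P mXys C = mscale (NngNum QA0) (mrestr P mys) C.
  rewrite /mscale/= /mrestr QAE [C `&` y u @^-1` _]setIC => <-.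
  by congr (P _); rewrite [RHS]setIC -setIA setICA.
apply: (g_sigma_algebra_measure_unique (rest_events u) _ (fun=> setT)) => //.
- exact: rest_events_measurable.
- by move=> _; exact: rest_eventsT.
- by rewrite bigcup_const.
- exact: rest_events_setI.
(* Conditional independence is applied to J and to J with u added. On {y_u = s} the extra factor in
   the second product is the constant Q s A, which comes out of the integral. *)
- move=> _ [E [J [A' [sE uJ mA' ->]]]].
  have sEy : <<s tree_events >> (E `&` y u @^-1` [set s]).
    by apply: tree_eventsI => //; exact: tree_events_label.
  rewrite /= /mrestr /mscale/= QAE.
  have := features_cond_indep limit_object J sEy mA'.
  have mA'' v : measurable (if v == u then A else A' v) by case: ifP.
  have := features_cond_indep limit_object (u |` J)%fset sEy mA''.
  rewrite (_ : E `&` y u @^-1` [set s] `&` _ =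
    E `&` \bigcap_(v in [set` J]) X v @^-1` A' v `&`
      (X u @^-1` A `&` y u @^-1` [set s])); last first.
    apply/seteqP; split => w /=.
      move=> [[Ew ys] H]; split.
        split=> // v /= vJ; have := H v (fset1Ur _ vJ).
        by rewrite /= ifN//; apply: contraNneq uJ => <-.
      by split => //; have := H u (fset1U1 u J); rewrite /= eqxx.
    move=> [[Ew H] [Aw ys]]; split => // v /=; rewrite in_fset1U.
    by case: eqP => [->//|vu /= vJ]; exact: H.
  move=> ->.
  rewrite (_ : E `&` y u @^-1` [set s] `&` _ =
    E `&` \bigcap_(v in [set` J]) X v @^-1` A' v `&` y u @^-1` [set s]); last first.
    by rewrite setIAC.
  rewrite /mrestr => ->.
  have mQ v : measurable_fun setT (fun w => (if y v w then Pp else Pm) (A' v)).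
    exact: (measurableT_comp (f := fun b : bool => (if b then Pp else Pm) (A' v))).
  have mEy := tree_events_measurable sEy.
  rewrite -ge0_integralZl//; last 2 first.
  - apply: measurable_funTS.
    elim: (enum_fset J) => [|v J' IH].
      by under eq_fun do rewrite big_nil; exact: measurable_cst.
    by under eq_fun do rewrite big_cons; exact: emeasurable_funM.
  - move=> w _; elim: (enum_fset J) => [|v J' IH]; rewrite ?big_nil// big_cons.
    by rewrite mule_ge0//; case: ifP.
  apply: eq_integral => w; rewrite inE => -[_ /= ys].
  rewrite big_fsetU1//= eqxx ys; congr (_ * _).
  apply: eq_big_seq => v vJ; suff /negbTE -> : v != u by [].
  by apply: contraNneq uJ => <-.
- by move=> _; rewrite /= ltey_eq fin_num_measure.
Qed.

(** The type of the source of [Z] expresses measurability with respect to the tree, the labels and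
    the features other than the one at [u]. *)
Lemma integral_feature (dT : measure_display) (T : measurableType dT) u s
    (Z : g_sigma_algebraType (rest_events u) -> T)
    (h : d.-tuple R * T -> \bar R) :
  measurable_fun setT Z -> measurable_fun setT h -> (forall z, 0 <= h z) ->
  \int[P]_(w in y u @^-1` [set s]) h (X u w, Z w) =
  \int[P]_(w in y u @^-1` [set s]) \int[Q s]_x h (x, Z w).
Proof.
move=> mZ mh h0.
have ZC B : measurable B -> <<s rest_events u >> (Z @^-1` B).
  by move=> mB; have := mZ measurableT B mB; rewrite setTI.
apply: (@independent_integral _ _ _ _ _ _ _ _ _ _ (X u) Z h) => //.
- by apply: tree_events_measurable; exact: tree_events_label.
- move=> _ B mB; rewrite setTI.
  apply: smallest_sub (ZC B mB); last exact: rest_events_measurable.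
  exact: sigma_algebra_measurable.
- by move=> A B mA mB; apply: feature_independence => //; exact: ZC.
Qed.

End feature_independence.

Section feature_expectation.
Context (R : realType) (d : nat) (dO : measure_display)
  (Omega : measurableType dO) (P : probability Omega R) (Delta gamma : R)
  (Pp Pm : probability (d.-tuple R) R)
  (K : vertex -> {RV P >-> nat}) (y : vertex -> {RV P >-> bool})
  (X : vertex -> {RV P >-> d.-tuple R}).

Lemma rest_measurable_fun (dT : measure_display) (T : measurableType dT) u
    (Z : g_sigma_algebraType (rest_events K y X u) -> T) :
  measurable_fun setT Z -> measurable_fun setT (Z : Omega -> T).
Proof.
move=> mZ _ B mB; have := mZ measurableT B mB; rewrite !setTI.
apply: smallest_sub; last exact: rest_events_measurable.
exact: sigma_algebra_measurable.
Qed.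

Hypothesis limit_object : is_limit_object Delta gamma Pp Pm K y X.

Let Q (s : bool) := if s then Pp else Pm.

Let bounded_mean u (f : d.-tuple R -> R) :
  bounded_mfun (fun w => \int[Q (y u w)]_x f x : R).
Proof.
have -> : (fun w => \int[Q (y u w)]_x f x) =
    (fun w => \int[Pm]_x f x +
      (\int[Pp]_x f x - \int[Pm]_x f x) * \1_(y u @^-1` [set true]) w).
  apply/funext => w; rewrite indicE.
  case: (boolP (y u w)) => [e|/negbTE e].
    by rewrite mem_set//= /Q mulr1 addrC subrK.
  by rewrite memNset/= ?e// /Q mulr0 addr0.
apply: bounded_mfunD; first exact: bounded_mfun_cst.
apply: bounded_mfunM; first exact: bounded_mfun_cst.
by apply: bounded_mfun_indic; rewrite -[_ @^-1` _]setTI; exact: measurable_funPT.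
Qed.

Let bounded_feature u (f : d.-tuple R -> R) :
  bounded_mfun f -> bounded_mfun (fun w => f (X u w)).
Proof.
move=> [mf [C fC]]; split; last by exists C.
by apply: measurableT_comp => //; exact: measurable_funPT.
Qed.

Let expectation_feature_ge0 u (f : d.-tuple R -> R)
    (Z : g_sigma_algebraType (rest_events K y X u) -> R) :
  bounded_mfun f -> bounded_mfun Z ->
  (forall x, 0 <= f x) -> (forall w, 0 <= Z w) ->
  \int[P]_w (f (X u w) * Z w) = \int[P]_w ((\int[Q (y u w)]_x f x) * Z w).
Proof.
move=> bf [mZ bZ] f0 Z0.
have mfX : measurable_fun setT (fun w => f (X u w)) by have [] := bounded_feature u bf.
have mfZ : measurable_fun setT (fun w => f (X u w) * Z w).
  by apply: measurable_funM => //; exact: rest_measurable_fun.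
have mQZ : measurable_fun setT (fun w => (\int[Q (y u w)]_x f x) * Z w).
  apply: measurable_funM; last exact: rest_measurable_fun.
  by have [] := bounded_mean u f.
have Qf0 s : 0 <= \int[Q s]_x f x by apply: Rintegral_ge0.
have mys s : measurable (y u @^-1` [set s]).
  by rewrite -[_ @^-1` _]setTI; exact: measurable_funPT.
have -> : [set: Omega] = y u @^-1` [set true] `|` y u @^-1` [set false].
  by apply/esym/seteqP; split => // w _ /=; case: (y u w); [left|right].
rewrite /Rintegral; congr fine.
have dis : [disjoint y u @^-1` [set true] & y u @^-1` [set false]].
  apply/disj_setPS => w [/= ->]; by [].
rewrite !ge0_integral_setU//; last 4 first.
- exact/measurable_EFinP/measurable_funTS.
- by move=> w _; rewrite lee_fin mulr_ge0//; exact: Qf0.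
- exact/measurable_EFinP/measurable_funTS.
- by move=> w _; rewrite lee_fin mulr_ge0//; exact: Qf0.
suff E s : (\int[P]_(w in y u @^-1` [set s]) (f (X u w) * Z w)%:E =
    \int[P]_(w in y u @^-1` [set s]) ((\int[Q (y u w)]_x f x) * Z w)%:E)%E.
  by rewrite !E.
(* The absolute value makes [h] nonnegative on the whole product space, as [integral_feature]
   requires, without changing it at the values taken. *)
pose h (p : d.-tuple R * R) : \bar R := `|f p.1 * p.2|%:E.
transitivity (\int[P]_(w in y u @^-1` [set s]) h (X u w, Z w))%E.
  by apply: eq_integral => w _; rewrite /h/= ger0_norm// mulr_ge0.
have mh : measurable_fun setT h.
  apply/measurable_EFinP; apply: measurableT_comp => //.
  apply: measurable_funM; last exact: measurable_snd.
  by apply: (measurableT_comp (f := f)) => //; case: bf.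
have h0 z : (0 <= h z)%E by rewrite lee_fin normr_ge0.
rewrite (integral_feature limit_object s mZ mh h0).
apply: eq_integral => w; rewrite inE/= => ->; rewrite -/(Q s) /h/=.
rewrite -RintegralZr//; last exact: bounded_mfun_integrable.
rewrite fineK; last first.
  apply: integrable_fin_num => //.
  apply: (@bounded_mfun_integrable _ _ _ _ (fun x => f x * Z w)).
  by apply: bounded_mfunM => //; exact: bounded_mfun_cst.
by apply: eq_integral => x _; rewrite ger0_norm// mulr_ge0.
Qed.

(** Signs are removed by adding a bound: the identity for Z + D minus the one for D handles Z, and
    then the same is done with f + C. *)
Lemma expectation_feature u (f : d.-tuple R -> R)
    (Z : g_sigma_algebraType (rest_events K y X u) -> R) :
  bounded_mfun f -> bounded_mfun Z ->
  \int[P]_w (f (X u w) * Z w) =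
  \int[P]_w ((\int[(if y u w then Pp else Pm)]_x f x) * Z w).
Proof.
move=> bf bZ.
have bZ' (W : g_sigma_algebraType (rest_events K y X u) -> R) :
    bounded_mfun W -> bounded_mfun (W : Omega -> R).
  by move=> [mW bW]; split => //; exact: rest_measurable_fun.
have step1 (g : d.-tuple R -> R) : bounded_mfun g -> (forall x, 0 <= g x) ->
    \int[P]_w (g (X u w) * Z w) = \int[P]_w ((\int[Q (y u w)]_x g x) * Z w).
  move=> bg g0; have [_ [D ZD]] := bZ.
  have bD : bounded_mfun (fun _ : g_sigma_algebraType (rest_events K y X u) => D : R).
    exact: bounded_mfun_cst.
  have bDO : bounded_mfun (fun _ : Omega => D : R) by exact: bounded_mfun_cst.
  have bZD : bounded_mfun (fun w => Z w + D) by exact: bounded_mfunD.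
  have D0 : 0 <= D by exact: le_trans (normr_ge0 _) (ZD point).
  have := expectation_feature_ge0 bg bZD g0.
  have := expectation_feature_ge0 bg bD g0.
  move=> /(_ (fun=> D0)) E1 /(_ _)/wrap[].
    by move=> w; rewrite -lerBlDr sub0r; have := ZD w; rewrite ler_norml => /andP[].
  under eq_Rintegral do rewrite mulrDr.
  under [in RHS]eq_Rintegral do rewrite mulrDr.
  have bgX := bounded_feature u bg.
  rewrite !Rintegral_bounded_mfunD ?E1; first by move/addIr.
  - by apply: bounded_mfunM; [exact: bounded_mean|exact: bZ'].
  - by apply: bounded_mfunM; [exact: bounded_mean|].
  - by apply: bounded_mfunM; [|exact: bZ'].
  - exact: bounded_mfunM.
have [_ [C fC]] := bf.
have C0 : 0 <= C by exact: le_trans (normr_ge0 _) (fC point).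
have bC : bounded_mfun (fun _ : d.-tuple R => C : R) by exact: bounded_mfun_cst.
have bfC : bounded_mfun (fun x => f x + C) by exact: bounded_mfunD.
have := step1 _ bfC; have := step1 _ bC (fun=> C0).
move=> E1 /(_ _)/wrap[].
  by move=> w; rewrite -lerBlDr sub0r; have := fC w; rewrite ler_norml => /andP[].
under eq_Rintegral do rewrite mulrDl.
under [in RHS]eq_Rintegral do rewrite Rintegral_bounded_mfunD// mulrDl.
have bfX := bounded_feature u bf.
have bCX := bounded_feature u bC.
rewrite !Rintegral_bounded_mfunD ?E1; first by move/addIr.
- by apply: bounded_mfunM; [exact: bounded_mean|exact: bZ'].
- by apply: bounded_mfunM; [exact: bounded_mean|exact: bZ'].
- by apply: bounded_mfunM; [|exact: bZ'].
- by apply: bounded_mfunM; [|exact: bZ'].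
Qed.

End feature_expectation.

(** * Second moments on the truncated tree *)

Section second_moment.
Context (R : realType) (d : nat) (dO : measure_display)
  (Omega : measurableType dO) (P : probability Omega R) (Delta gamma : R)
  (Pp Pm : probability (d.-tuple R) R)
  (K : vertex -> {RV P >-> nat}) (y : vertex -> {RV P >-> bool})
  (X : vertex -> {RV P >-> d.-tuple R}).

Let rest u := g_sigma_algebraType (rest_events K y X u).

Lemma tree_events_intree u :
  <<s tree_events K y >> [set w | intree (fun v => K v w) [::] u].
Proof.
suff H v : <<s tree_events K y >> [set w | intree (fun v => K v w) v u] by [].
elim: u v => [|i u IH] v /=.
  by rewrite (_ : mkset _ = setT); [exact: tree_eventsT|exact/seteqP].
rewrite (_ : mkset _ = K v @^-1` [set k | (i < k)%N] `&`
  [set w | intree (fun v => K v w) (rcons v i) u]).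
  by apply: tree_eventsI => //; exact: tree_events_offspring.
by apply/seteqP; split => w /= /andP.
Qed.

Let bounded_rest_tree u E : <<s tree_events K y >> E ->
  bounded_mfun (\1_E : rest u -> R).
Proof.
by move=> sE; apply: bounded_mfun_indic; apply: sub_sigma_algebra; exact: rest_events_tree.
Qed.

Let bounded_rest_label u v : @bounded_mfun _ (rest u) R (fun w => sgl R (y v w)).
Proof.
have -> : (fun w => sgl R (y v w)) =
    (fun w => -1 + 2 * (\1_(y v @^-1` [set true]) w : R)).
  apply/funext => w; rewrite indicE /sgl.
  case: (boolP (y v w)) => [e|/negbTE e].
    by rewrite mem_set//= mulr1; lra.
  by rewrite memNset/= ?e// mulr0 addr0.
apply: bounded_mfunD; first exact: bounded_mfun_cst.
apply: bounded_mfunM; first exact: bounded_mfun_cst.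
by apply: bounded_rest_tree; exact: tree_events_label.
Qed.

Let bounded_rest_feature u v (f : d.-tuple R -> R) : u != v ->
  bounded_mfun f -> @bounded_mfun _ (rest u) R (fun w => f (X v w)).
Proof.
move=> uv [mf [C fC]]; split; last by exists C.
move=> _ B mB; rewrite setTI; apply: sub_sigma_algebra.
have := mf measurableT B mB; rewrite setTI => mfB.
exact: (rest_events_feature K y X uv mfB).
Qed.

Let bounded_of_rest u (Z : rest u -> R) :
  bounded_mfun Z -> @bounded_mfun _ Omega R Z.
Proof. by move=> [mZ bZ]; split => //; exact: (rest_measurable_fun mZ). Qed.

Let bounded_tree E : <<s tree_events K y >> E ->
  bounded_mfun (\1_E : Omega -> R).
Proof. by move=> sE; exact: (bounded_of_rest (bounded_rest_tree [::] sE)). Qed.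

Let bounded_label v : @bounded_mfun _ Omega R (fun w => sgl R (y v w)).
Proof. exact: (bounded_of_rest (bounded_rest_label [::] v)). Qed.

Let bounded_feature v (f : d.-tuple R -> R) :
  bounded_mfun f -> @bounded_mfun _ Omega R (fun w => f (X v w)).
Proof.
(* Any vertex other than [v] would do: its [rest] sigma-algebra contains the feature at [v]. *)
have uv : rcons v 0%N != v.
  by apply/eqP => /(congr1 size)/eqP; rewrite size_rcons gtn_eqF.
by move=> bf; exact: (bounded_of_rest (bounded_rest_feature uv bf)).
Qed.

Hypothesis Delta1 : 0 < Delta.
Hypothesis gamma0 : 0 <= gamma.
Hypothesis limit_object : is_limit_object Delta gamma Pp Pm K y X.

(** To be instantiated by M_k, its mean and second moment under P_+, and A = c_gamma^2 vartheta.
    Index 0 is excluded because M_0 may be unbounded. *)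
Variables (f : nat -> d.-tuple R -> R) (m q : nat -> R) (A : R).
Hypothesis bounded_f : forall k, (0 < k)%N -> bounded_mfun (f k).
Hypothesis mean_f : forall k s, (0 < k)%N ->
  \int[(if s then Pp else Pm)]_x f k x = sgl R s * m k.
Hypothesis mean_f2 : forall k s, (0 < k)%N ->
  \int[(if s then Pp else Pm)]_x (f k x ^+ 2) = q k.
Hypothesis mm_le : forall k l, (0 < k)%N -> (0 < l)%N ->
  m k * m l <= A * gamma ^+ (k + l).
Hypothesis q_le : forall k, (0 < k)%N -> q k <= A * gamma ^+ (k + k).

Let Q (s : bool) := if s then Pp else Pm.

(** The features are integrated out one at a time: X_v belongs to the rest for u, and after X_u has
    become a multiple of y_u, what is left belongs to the rest for v. *)
Let expectation_feature_pair u v k l E : (0 < k)%N -> (0 < l)%N -> u != v ->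
  <<s tree_events K y >> E ->
  \int[P]_w (\1_E w * (f k (X u w) * f l (X v w))) =
  m k * m l * \int[P]_w (\1_E w * (sgl R (y u w) * sgl R (y v w))).
Proof.
move=> k0 l0 uv sE.
transitivity (\int[P]_w (f k (X u w) * (\1_E w * f l (X v w)))).
  by apply: eq_Rintegral => w _; rewrite mulrCA.
rewrite (expectation_feature limit_object (bounded_f k0)); last first.
  apply: (bounded_mfunM (bounded_rest_tree u sE)).
  exact: (bounded_rest_feature uv (bounded_f l0)).
transitivity (\int[P]_w (f l (X v w) * (m k * (sgl R (y u w) * \1_E w)))).
  by apply: eq_Rintegral => w _; rewrite mean_f//; ring.
rewrite (expectation_feature limit_object (bounded_f l0)); last first.
  apply: (@bounded_mfunM _ (rest v)); first exact: bounded_mfun_cst.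
  exact: (bounded_mfunM (bounded_rest_label v u) (bounded_rest_tree v sE)).
rewrite -Rintegral_bounded_mfunZ; last first.
  by apply: bounded_mfunM; [exact: bounded_tree|exact: bounded_mfunM].
by apply: eq_Rintegral => w _; rewrite mean_f//; ring.
Qed.

Let tail := poisson_tail Delta.
Let intreeb u w := intree (fun v => K v w) [::] u.

(** Off the diagonal the product of means appears, on it the second moment with y_u^2 = 1. Both obey
    the same bound A gamma^(k+l), so one formula covers all pairs; nonnegativity of [pair_weight]
    allows multiplying by it. *)
Let pair_le u v : (0 < size u)%N -> (0 < size v)%N ->
  \int[P]_w ((intreeb u w && intreeb v w)%:R *
    (f (size u) (X u w) * f (size v) (X v w))) <=
  A * gamma ^+ (size u + size v) * pair_weight tail gamma u v.
Proof.
move=> u0 v0; pose E := [set w | intreeb u w] `&` [set w | intreeb v w].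
have sE : <<s tree_events K y >> E.
  by apply: tree_eventsI; exact: tree_events_intree.
have EE w : (intreeb u w && intreeb v w)%:R = \1_E w :> R.
  rewrite indicE; case: (boolP (_ && _)) => [/andP uv|uv].
    by rewrite mem_set.
  by rewrite memNset// => -[? ?]; move/negP: uv; apply; apply/andP.
rewrite -(expectation_label_pair limit_object u v).
under eq_Rintegral do rewrite EE.
under [in leRHS]eq_Rintegral do rewrite -/(intreeb _ _) -/(intreeb _ _) EE.
have W0 : 0 <= \int[P]_w (\1_E w * (sgl R (y u w) * sgl R (y v w))).
  under eq_Rintegral do rewrite -EE.
  rewrite (expectation_label_pair limit_object u v).
  by apply: pair_weight_ge0 => // i; exact: poisson_tail_ge0.
have [uv|uv] := eqVneq u v; last first.
  by rewrite expectation_feature_pair// ler_wpM2r// mm_le.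
rewrite -{}uv in E sE EE W0 *.
have E1 : \int[P]_w (\1_E w * (sgl R (y u w) * sgl R (y u w))) = \int[P]_w \1_E w.
  by apply: eq_Rintegral => w _; rewrite /sgl; case: (y u w); rewrite ?mulrNN !mulr1.
have bf2 : bounded_mfun (fun x => f (size u) x ^+ 2).
  by under eq_fun do rewrite expr2; exact: bounded_mfunM (bounded_f u0) (bounded_f u0).
rewrite E1 in W0 *.
suff -> : \int[P]_w (\1_E w * (f (size u) (X u w) * f (size u) (X u w))) =
    q (size u) * \int[P]_w \1_E w by rewrite ler_wpM2r// q_le.
rewrite -Rintegral_bounded_mfunZ; last exact: bounded_tree.
under eq_Rintegral do rewrite mulrC -expr2.
rewrite (expectation_feature limit_object bf2 (bounded_rest_tree u sE)).
by under eq_Rintegral do rewrite mean_f2//.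
Qed.

Definition truncated_sum n k w : R :=
  \sum_(v <- generation (fun v => minn (K v w) n) k) f k (X v w).

Let truncated_sumE n k w : truncated_sum n k w =
  \sum_(u <- words n k) (intreeb u w)%:R * f k (X u w).
Proof.
rewrite /truncated_sum sum_truncated_generation.
by apply: eq_bigr => u _; rewrite mulr_natl.
Qed.

Lemma size_generation (L : vertex -> nat) k v :
  v \in generation L k -> size v = k.
Proof.
elim: k v => [|k IH] v /=; first by rewrite inE => /eqP ->.
by move=> /flattenP[_ /mapP[u /IH uk ->] /mapP[i _ ->]]; rewrite size_rcons uk.
Qed.

Let bounded_term k u : (0 < k)%N ->
  @bounded_mfun _ Omega R (fun w => (intreeb u w)%:R * f k (X u w)).
Proof.
move=> k0; apply: bounded_mfunM; last exact: bounded_feature (bounded_f k0).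
have -> : (fun w => (intreeb u w)%:R) = (\1_[set w | intreeb u w] : Omega -> R).
  apply/funext => w; rewrite indicE; case: (boolP (intreeb u w)) => uw.
    by rewrite mem_set.
  by rewrite memNset//; exact/negP.
by apply: bounded_tree; exact: tree_events_intree.
Qed.

Lemma bounded_truncated_sum n k : (0 < k)%N -> bounded_mfun (truncated_sum n k).
Proof.
move=> k0; have -> : truncated_sum n k =
    fun w => \sum_(u <- words n k) (intreeb u w)%:R * f k (X u w).
  by apply/funext => w; rewrite truncated_sumE.
by apply: bounded_mfun_sum => u; exact: bounded_term.
Qed.

Lemma truncated_sum_pair n k l : (0 < k)%N -> (0 < l)%N ->
  \int[P]_w (truncated_sum n k w * truncated_sum n l w) <=
  A * gamma ^+ (k + l) * pair_sum tail gamma n k l.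
Proof.
move=> k0 l0.
under eq_Rintegral do rewrite !truncated_sumE big_distrl/=.
rewrite Rintegral_bounded_mfun_sum; last first.
  move=> u; apply: bounded_mfunM; first exact: bounded_term.
  by apply: bounded_mfun_sum => v; exact: bounded_term.
rewrite /pair_sum big_distrr/= big_seq [leRHS]big_seq.
apply: ler_sum => u /size_generation uk.
under eq_Rintegral do rewrite big_distrr/=.
rewrite Rintegral_bounded_mfun_sum; last first.
  by move=> v; apply: bounded_mfunM; exact: bounded_term.
rewrite big_distrr/= big_seq [leRHS]big_seq.
apply: ler_sum => v /size_generation vl.
apply: le_trans (_ : \int[P]_w ((intreeb u w && intreeb v w)%:R *
    (f (size u) (X u w) * f (size v) (X v w))) <= _).
  rewrite le_eqVlt; apply/orP; left; apply/eqP; apply: eq_Rintegral => w _.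
  by rewrite uk vl -mulnb natrM; ring.
by rewrite -uk -vl pair_le// ?uk ?vl.
Qed.

Let kappa := gamma ^+ 2 * Delta.
Hypothesis A0 : 0 <= A.
Hypothesis kappa1 : kappa < 1.

(** One factor 1/(1 - kappa) comes from [pair_sum_le] and two from [sum_expr_max]; the 2 bounds 1 +
    kappa. *)
Lemma truncated_second_moment n l N :
  \int[P]_w ((\sum_(i < N) truncated_sum n (l.+1 + i) w) ^+ 2) <=
  2 * A / (1 - kappa) ^+ 3 * kappa ^+ l.+1.
Proof.
have bS i : bounded_mfun (truncated_sum n (l.+1 + i)).
  by apply: bounded_truncated_sum; rewrite addSn.
have kappa0 : 0 <= kappa by rewrite mulr_ge0 ?exprn_ge0// ltW.
have K0 : 0 < 1 - kappa by rewrite subr_gt0.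
under eq_Rintegral do rewrite expr2 big_distrl/=.
rewrite Rintegral_bounded_mfun_sum; last first.
  by move=> i; apply: bounded_mfunM => //; exact: bounded_mfun_sum.
apply: le_trans (_ : \sum_(i < N) \sum_(j < N)
    A / (1 - kappa) * kappa ^+ l.+1 * kappa ^+ maxn i j <= _).
  apply: ler_sum => i _.
  under eq_Rintegral do rewrite big_distrr/=.
  rewrite Rintegral_bounded_mfun_sum; last by move=> j; exact: bounded_mfunM.
  apply: ler_sum => j _.
  apply: le_trans (truncated_sum_pair n _ _) _; rewrite ?addSn//.
  rewrite -mulrA -!mulrA ler_wpM2l// ler_pdivlMl// -exprD.
  have p0 := poisson_tail_ge0 Delta1.
  have := pair_sum_le p0 gamma0 (sum_poisson_tail Delta1 n)
    (sum_poisson_tail2 Delta1 n) (ltW kappa1) (l.+1 + i) (l.+1 + j).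
  (* The shift l+1 comes out of the maximum, and the subtracted power of kappa is dropped. *)
  rewrite -addn_maxr !addSn => H; apply: le_trans H _.
  by rewrite gerBl exprn_ge0.
under eq_bigr do rewrite -big_distrr/=.
rewrite -big_distrr/=.
have {}kappa1' : 0 <= kappa <= 1 by rewrite kappa0 ltW.
have := sum_expr_max N kappa1'.
set S := \sum_(k < N) _; rewrite mulrC -ler_pdivlMr ?exprn_gt0// => SN.
apply: le_trans (_ : A / (1 - kappa) * kappa ^+ l.+1 * (2 / (1 - kappa) ^+ 2) <= _).
  rewrite ler_wpM2l ?mulr_ge0 ?exprn_ge0 ?invr_ge0 ?(ltW K0)//.
  apply: le_trans SN _; rewrite ler_wpM2r ?invr_ge0 ?exprn_ge0 ?(ltW K0)//.
  by rewrite -natr1 addrC lerD2r ltW.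
rewrite le_eqVlt; apply/orP; left; apply/eqP.
by field; rewrite gt_eqF.
Qed.

End second_moment.

(** * The feature statistics M_k *)

Section artanh_bounds.
Context (R : realType).
Implicit Types x u z : R.

Lemma expR_ge_quadratic u : 0 <= u -> 1 + u + u ^+ 2 / 2 <= expR u.
Proof.
move=> u0; rewrite (_ : _ + _ = series (exp_coeff u) 3); last first.
  rewrite /series/= !big_nat_recr//= big_geq// /exp_coeff/= expr0 expr1.
  by rewrite !factS fact0 !mul1n divr1 add0r muln1 invr1 mulr1.
apply: (nondecreasing_cvgn_le _ _ 3); last exact: is_cvg_series_exp_coeff.
apply/nondecreasing_seqP => N; rewrite seriesSr lerDl.
by rewrite /exp_coeff/= divr_ge0// exprn_ge0.
Qed.

(* The hyperbolic inequality u <= sinh u at u = ln z; it follows from the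
   quadratic lower bound s of exp, as s^2 - 1 >= 2 u s. *)
Lemma ln_le_sinh z : 1 <= z -> 2 * ln z <= z - z^-1.
Proof.
move=> z1; have z0 : 0 < z by exact: lt_le_trans z1.
have u0 : 0 <= ln z by exact: ln_ge0.
have := expR_ge_quadratic u0; rewrite lnK ?posrE//.
set u := ln z; set s := 1 + u + _ => sz.
have s0 : 0 < s.
  by rewrite /s -addrA ltr_pwDl// addr_ge0// divr_ge0// exprn_ge0.
apply: le_trans (_ : s - s^-1 <= _).
  rewrite -(ler_pM2r s0) mulrBl mulVf ?gt_eqF// /s -subr_ge0.
  have -> : (1 + u + u ^+ 2 / 2) * (1 + u + u ^+ 2 / 2) - 1 -
      2 * u * (1 + u + u ^+ 2 / 2) = u ^+ 4 / 4 by field.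
  by rewrite divr_ge0// exprn_ge0.
by rewrite lerB// lef_pV2// posrE.
Qed.

Lemma artanhN x : -1 < x < 1 -> artanh (- x) = - artanh x.
Proof.
move=> /andP[x1 x2]; rewrite /artanh opprK.
have p1 : 0 < 1 + x by rewrite -ltrBlDl sub0r.
have p2 : 0 < 1 - x by rewrite subr_gt0.
have -> : (1 - x) / (1 + x) = ((1 + x) / (1 - x))^-1 by rewrite invf_div.
by rewrite lnV ?mulNr// posrE divr_gt0.
Qed.

Lemma artanh_ge0 x : 0 <= x < 1 -> 0 <= artanh x.
Proof.
move=> /andP[x0 x1]; rewrite /artanh divr_ge0// ln_ge0//.
rewrite ler_pdivlMr ?subr_gt0// mul1r lerD2l.
by rewrite (le_trans _ x0)// oppr_le0.
Qed.

(** At z = (1+x)/(1-x) the difference z - 1/z equals 4x/(1 - x^2). *)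
Lemma artanh_le x : 0 <= x < 1 -> artanh x <= x / (1 - x ^+ 2).
Proof.
move=> /andP[x0 x1].
have p1 : 0 < 1 + x by rewrite ltr_pwDl.
have p2 : 0 < 1 - x by rewrite subr_gt0.
have z1 : 1 <= (1 + x) / (1 - x).
  rewrite ler_pdivlMr// mul1r lerD2l.
  by rewrite (le_trans _ x0)// oppr_le0.
have := ln_le_sinh z1; rewrite /artanh => H.
rewrite ler_pdivrMr// -(ler_pM2l (ltr0Sn R 1)); apply: le_trans H _.
have n1 : 1 + x != 0 by rewrite gt_eqF.
have n2 : 1 - x != 0 by rewrite gt_eqF.
rewrite le_eqVlt; apply/orP; left; apply/eqP.
rewrite (_ : 1 - x ^+ 2 = (1 - x) * (1 + x)); last by ring.
by field; rewrite n1.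
Qed.

Lemma norm_artanh_le x r : `|x| <= r -> r < 1 ->
  `|2 * artanh x| <= 2 / (1 - r ^+ 2) * `|x|.
Proof.
move=> xr r1.
have n1 : `|x| < 1 by exact: le_lt_trans r1.
have E : `|artanh x| = artanh `|x|.
  have [x0|x0] := leP 0 x.
    by rewrite !ger0_norm// artanh_ge0// x0 -[X in X < _]ger0_norm.
  rewrite (ltr0_norm x0) artanhN; last by rewrite -ltr_norml.
  rewrite ler0_norm// -oppr_ge0 -artanhN; last by rewrite -ltr_norml.
  by rewrite artanh_ge0// oppr_ge0 ltW//= -ltr0_norm.
rewrite normrM ger0_norm// E.
have r0 : 0 <= r by exact: le_trans xr.
apply: le_trans (_ : 2 * (`|x| / (1 - `|x| ^+ 2)) <= _).
  by rewrite ler_wpM2l// artanh_le// normr_ge0.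
rewrite mulrAC -mulrA ler_wpM2l// ler_wpM2l//.
have x2 : `|x| ^+ 2 <= r ^+ 2 by rewrite lerXn2r// nnegrE.
have r2 : r ^+ 2 < 1 by rewrite expr_lt1.
by rewrite lef_pV2 ?posrE ?subr_gt0// ?lerB// (le_lt_trans x2).
Qed.

End artanh_bounds.

(** For nonnegative reals, 0 included, the inverse is the power -1, which is a measurable
    function. *)
Lemma measurable_fun_div_ge0 (dT : measure_display) (T : measurableType dT)
    (R : realType) (f g : T -> R) :
  measurable_fun setT f -> measurable_fun setT g -> (forall x, 0 <= g x) ->
  measurable_fun setT (fun x => f x / g x).
Proof.
move=> mf mg g0; apply: measurable_funM => //.
rewrite (_ : (fun x => (g x)^-1) = (fun x => g x `^ (-1))); last first.
  by apply/funext => x; rewrite powR_inv1.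
by apply: (measurableT_comp (f := fun z : R => z `^ (-1))) => //; exact: measurable_powR.
Qed.

Section feature_statistics.
Context (R : realType) (dT : measure_display) (T : measurableType dT).
Variables (mu : {measure set T -> \bar R}) (Pp Pm : probability T R).
Variables (rp rm : T -> R) (gamma : R).
Hypothesis A1 : assumption1 mu Pp Pm rp rm.
Hypothesis gamma01 : 0 < gamma < 1.

Let t := tstat rp rm.
Let M := Mk rp rm gamma.

Let rp0 x : 0 <= rp x. Proof. by have [_ + _] := density_p A1; exact. Qed.
Let rm0 x : 0 <= rm x. Proof. by have [_ + _] := density_m A1; exact. Qed.
Let mrp : measurable_fun setT rp. Proof. by have [] := density_p A1. Qed.
Let mrm : measurable_fun setT rm. Proof. by have [] := density_m A1. Qed.

Lemma measurable_tstat : measurable_fun setT t.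
Proof.
apply: measurable_fun_div_ge0; first exact: measurable_funB.
  exact: measurable_funD.
by move=> x; exact: addr_ge0.
Qed.

Lemma norm_tstat x : `|t x| <= 1.
Proof.
rewrite /t /tstat normrM normfV (ger0_norm (addr_ge0 (rp0 x) (rm0 x))).
have := addr_ge0 (rp0 x) (rm0 x); rewrite le_eqVlt => /predU1P[<-|s0].
  by rewrite invr0 mulr0.
rewrite ler_pdivrMr// mul1r ler_norml; apply/andP; split.
  by rewrite opprD lerD2r (le_trans _ (rp0 x))// oppr_le0.
by rewrite lerD2l (le_trans _ (rm0 x))// oppr_le0.
Qed.

Lemma measurable_Mk k : measurable_fun setT (M k).
Proof.
rewrite /M /Mk /artanh; apply: measurable_funM => //; apply: measurable_funM => //.
apply: measurableT_comp => //; apply: measurable_fun_div_ge0.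
- apply: measurable_funD => //; apply: measurable_funM => //; exact: measurable_tstat.
- apply: measurable_funB => //; apply: measurable_funM => //; exact: measurable_tstat.
- move=> x; rewrite subr_ge0 (le_trans (ler_norm _))// normrM.
  have /andP[g0 g1] := gamma01.
  by rewrite mulr_ile1// ?norm_tstat// normrX ger0_norm ?(ltW g0)// exprn_ile1 ?ltW.
Qed.

Let c := 2 / (1 - gamma ^+ 2).

(** For k >= 1 the argument of artanh stays in [-gamma, gamma], so the linear bound there has the
    constant c_gamma, uniformly in k. *)
Lemma norm_Mk_le k x : (0 < k)%N -> `|M k x| <= c * (gamma ^+ k * `|t x|).
Proof.
have /andP[g0 g1] := gamma01; move=> k0.
have gk : `|gamma ^+ k * t x| = gamma ^+ k * `|t x|.
  by rewrite normrM normrX (ger0_norm (ltW g0)).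
rewrite -gk; apply: norm_artanh_le => //; rewrite gk.
have gk1 : gamma ^+ k <= gamma.
  by rewrite -[leRHS]expr1 ler_wiXn2l// ltW.
by rewrite (le_trans _ gk1)// ler_piMr ?exprn_ge0 ?norm_tstat// ltW.
Qed.

Let c0 : 0 <= c.
Proof.
have /andP[g0 g1] := gamma01.
by rewrite divr_ge0// subr_ge0 exprn_ile1// ltW.
Qed.

Lemma bounded_Mk k : (0 < k)%N -> bounded_mfun (M k).
Proof.
have /andP[g0 g1] := gamma01.
move=> k0; split; first exact: measurable_Mk.
exists c => x; apply: le_trans (norm_Mk_le x k0) _.
rewrite ler_piMr// mulr_ile1// ?norm_tstat ?exprn_ge0 ?exprn_ile1//; exact: ltW.
Qed.

(** (1+t)/(1-t) = rho_+/rho_-. Where the denominator vanishes, x / 0 = 0 and ln 0 = 0 make both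
    sides 0, so the identity holds at every point. *)
Lemma Mk0 : M 0 = log_psi rp rm.
Proof.
apply/funext => x; rewrite /M /Mk expr0 mul1r /artanh /log_psi.
rewrite mulrCA divff ?mulr1//.
have [sx|sx] := eqVneq (rp x + rm x) 0.
  have /eqP : rp x = 0.
    apply/eqP; rewrite eq_le rp0 andbT -sx lerDl; exact: rm0.
  rewrite /tstat sx invr0 mulr0 addr0 subr0 divr1 ln1 => /eqP ->.
  by rewrite mul0r ln0.
have -> : 1 + tstat rp rm x = 2 * rp x / (rp x + rm x) by rewrite /tstat; field.
have -> : 1 - tstat rp rm x = 2 * rm x / (rp x + rm x) by rewrite /tstat; field.
have [->|rmx] := eqVneq (rm x) 0; first by rewrite mulr0 mul0r invr0 !mulr0.
by congr ln; field; rewrite sx rmx.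
Qed.

(** The exceptional set N of the assumption is enlarged by its preimage under tau, again null as tau
    preserves mu. Off the union the densities are exchanged in both directions. *)
Lemma feature_symmetry : exists tau : T -> T,
  [/\ measurable_fun setT tau,
      (forall A, measurable A -> Pm A = Pp (tau @^-1` A)) &
      {ae Pp, forall x, rm x = rp (tau x) /\ rp x = rm (tau x)}].
Proof.
have [tau [mtau mutau tauK rmE]] := symmetry A1.
have mtA A : measurable A -> measurable (tau @^-1` A).
  by move=> mA; rewrite -[_ @^-1` _]setTI; exact: mtau.
exists tau; split => // [A mA|].
  have [_ _ ->//] := density_m A1; have [_ _ ->] := density_p A1; last exact: mtA.
  transitivity (\int[mu]_(x in tau @^-1` (tau @^-1` A)) ((EFin \o rp) \o tau) x)%E.
    rewrite -comp_preimage (_ : tau \o tau = id); last exact/funext.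
    apply: ge0_ae_eq_integral => //.
    - exact/measurable_EFinP/measurable_funTS.
    - by apply: measurable_funTS; apply: measurableT_comp => //; exact/measurable_EFinP.
    - by move=> x _; rewrite lee_fin.
    - by move=> x _; rewrite lee_fin.
    - by apply: filterS rmE => x /= ->.
  rewrite -(ge0_integral_pushforward mtau)//; last 3 first.
  - exact: mtA.
  - exact/measurable_EFinP/measurable_funTS.
  - by move=> x _; rewrite lee_fin.
  by apply: eq_measure_integral => B mB _; rewrite /= /pushforward mutau.
have [N [mN N0 subN]] := rmE.
exists (N `|` tau @^-1` N); split.
- by apply: measurableU => //; exact: mtA.
- have [_ _ ->] := density_p A1; last by apply: measurableU => //; exact: mtA.
  apply: null_set_integral.
  + by apply: measurableU => //; exact: mtA.
  + exact/measurable_EFinP/measurable_funTS.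
  + apply/(negligibleP mu (measurableU _ _ mN (mtA N mN))).
    apply: negligibleU; first exact/negligibleP.
    by apply/negligibleP; [exact: mtA|exact: etrans (mutau _ mN) N0].
- move=> x /= nx; apply: contrapT => /not_orP[nNx nNtx]; apply: nx; split.
    by apply: contrapT => nx; apply: nNx; exact: subN.
  have : rm (tau x) = rp (tau (tau x)).
    by apply: contrapT => nx; apply: nNtx; exact: subN.
  by rewrite tauK.
Qed.

Let Q (s : bool) := if s then Pp else Pm.

(** Requiring g = h only at points with exchanged densities keeps tau out of the applications: t is
    odd under this exchange, hence M_k is odd and M_k^2 is even. *)
Lemma Rintegral_symmetry (g h : T -> R) : bounded_mfun g -> bounded_mfun h ->
  (forall x x', rm x = rp x' -> rp x = rm x' -> g x' = h x) ->
  \int[Pm]_x g x = \int[Pp]_x h x.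
Proof.
move=> bg bh gh; have [tau [mtau PmE taue]] := feature_symmetry.
have bgt : bounded_mfun (g \o tau).
  by have [mg [C gC]] := bg; split; [exact: measurableT_comp|exists C => x; exact: gC].
rewrite /Rintegral; congr fine.
transitivity (\int[pushforward Pp tau]_x (g x)%:E)%E.
  by apply: eq_measure_integral => B mB _; exact: PmE.
rewrite (integral_pushforward mtau)//; first last.
- exact: (bounded_mfun_integrable _ bgt).
- by apply/measurable_EFinP; case: bg.
rewrite preimage_setT; apply: ae_eq_integral => //.
- by have [/measurable_EFinP] := bgt.
- by have [/measurable_EFinP] := bh.
- by apply: filterS taue => x [rmx rpx] _ /=; rewrite (gh x).
Qed.

Let Mk_swap k x x' : (0 < k)%N -> rm x = rp x' -> rp x = rm x' -> M k x' = - M k x.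
Proof.
have /andP[g0 g1] := gamma01.
move=> k0 e1 e2; rewrite /M /Mk.
have -> : tstat rp rm x' = - tstat rp rm x.
  by rewrite /tstat e1 e2 -mulNr opprB [rm x' + _]addrC.
rewrite mulrN artanhN ?mulrN// -ltr_norml normrM.
rewrite (le_lt_trans (ler_piMr _ (norm_tstat x)))// normrX ger0_norm ?ltW//.
by rewrite exprn_ilt1 ?ltW// -lt0n.
Qed.

Definition mean_Mk k := \int[Pp]_x M k x.
Definition square_Mk k := \int[Pp]_x (M k x ^+ 2).

Lemma Rintegral_Mk k s : (0 < k)%N ->
  \int[(if s then Pp else Pm)]_x M k x = sgl R s * mean_Mk k.
Proof.
move=> k0; case: s; rewrite /sgl/= ?mul1r//.
have bM := bounded_Mk k0.
rewrite -Rintegral_bounded_mfunZ//; apply: Rintegral_symmetry => //.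
  by apply: bounded_mfunM => //; exact: bounded_mfun_cst.
by move=> x x' e1 e2; rewrite (Mk_swap k0 e1 e2) mulN1r.
Qed.

Let bounded_Mk2 k : (0 < k)%N -> bounded_mfun (fun x => M k x ^+ 2).
Proof.
move=> k0; under eq_fun do rewrite expr2.
exact: bounded_mfunM (bounded_Mk k0) (bounded_Mk k0).
Qed.

Lemma Rintegral_Mk2 k s : (0 < k)%N ->
  \int[(if s then Pp else Pm)]_x (M k x ^+ 2) = square_Mk k.
Proof.
move=> k0; case: s => //; apply: Rintegral_symmetry; [exact: bounded_Mk2..|].
by move=> x x' e1 e2; rewrite (Mk_swap k0 e1 e2) sqrrN.
Qed.

Let bounded_t : bounded_mfun t.
Proof. by split; [exact: measurable_tstat|exists 1; exact: norm_tstat]. Qed.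

Let theta := vartheta Pp rp rm.

Let bounded_t2 : bounded_mfun (fun x => t x ^+ 2).
Proof. by under eq_fun do rewrite expr2; exact: bounded_mfunM. Qed.

Let thetaE : theta = \int[Pp]_x (t x ^+ 2).
Proof. by rewrite /theta /vartheta unlock. Qed.

Let le_Rintegral_bounded (g h : T -> R) : bounded_mfun g -> bounded_mfun h ->
  (forall x, g x <= h x) -> \int[Pp]_x g x <= \int[Pp]_x h x.
Proof.
move=> bg bh gh; apply: le_Rintegral => //;
  [exact: bounded_mfun_integrable bg|exact: bounded_mfun_integrable bh].
Qed.

Lemma square_Mk_le k : (0 < k)%N ->
  square_Mk k <= c ^+ 2 * theta * gamma ^+ (k + k).
Proof.
move=> k0; rewrite thetaE mulrAC -Rintegral_bounded_mfunZ//.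
apply: le_Rintegral_bounded; first exact: bounded_Mk2.
  by apply: bounded_mfunM => //; exact: bounded_mfun_cst.
move=> x; rewrite -(real_normK (num_real (M k x))).
have -> : c ^+ 2 * gamma ^+ (k + k) * t x ^+ 2 = (c * (gamma ^+ k * `|t x|)) ^+ 2.
  by rewrite -(real_normK (num_real (t x))) !exprMn -exprM muln2 addnn mulrA.
have H := norm_Mk_le x k0.
by apply: lerXn2r => //; rewrite nnegrE//; exact: le_trans (normr_ge0 _) H.
Qed.

(** The variance of |t| is nonnegative. *)
Let norm_t_mean_sq : (\int[Pp]_x `|t x|) ^+ 2 <= theta.
Proof.
have bn : bounded_mfun (fun x => `|t x|).
  by split; [exact: measurableT_comp measurable_tstat|exists 1 => x; rewrite normr_id norm_tstat].
set e := \int[Pp]_x `|t x|.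
have : 0 <= \int[Pp]_x ((`|t x| - e) ^+ 2) by apply: Rintegral_ge0 => x _; exact: sqr_ge0.
have -> : (fun x => (`|t x| - e) ^+ 2) =
    fun x => t x ^+ 2 + ((- 2 * e) * `|t x| + e ^+ 2).
  by apply/funext => x; rewrite -(real_normK (num_real (t x))); ring.
have bc (r : R) : bounded_mfun (fun _ : T => r) by exact: bounded_mfun_cst.
have bn' : bounded_mfun (fun x => (- 2 * e) * `|t x|) by exact: bounded_mfunM.
rewrite Rintegral_bounded_mfunD//; last exact: bounded_mfunD.
rewrite Rintegral_bounded_mfunD// Rintegral_bounded_mfunZ//.
rewrite Rintegral_probability_cst -thetaE -/e.
have -> : theta + (- 2 * e * e + e ^+ 2) = theta - e ^+ 2 by ring.
by rewrite subr_ge0.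
Qed.

(** Each mean costs one factor E|t|, and (E|t|)^2 <= vartheta; the constant thus matches that of
    [square_Mk_le]. *)
Lemma mean_Mk_le k l : (0 < k)%N -> (0 < l)%N ->
  mean_Mk k * mean_Mk l <= c ^+ 2 * theta * gamma ^+ (k + l).
Proof.
have /andP[g0 g1] := gamma01; move=> k0 l0.
have bn : bounded_mfun (fun x => `|t x|).
  by split; [exact: measurableT_comp measurable_tstat|exists 1 => x; rewrite normr_id norm_tstat].
have H j : (0 < j)%N -> `|mean_Mk j| <= c * gamma ^+ j * \int[Pp]_x `|t x|.
  move=> j0; apply: le_trans (le_normr_Rintegral _ _) _ => //.
    exact: bounded_mfun_integrable (bounded_Mk j0).
  rewrite -Rintegral_bounded_mfunZ//; apply: le_Rintegral_bounded.
  - split; last by exists c => x; rewrite normr_id (le_trans (norm_Mk_le x j0))//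
      ler_piMr// mulr_ile1 ?norm_tstat ?exprn_ge0 ?exprn_ile1 ?(ltW g0) ?(ltW g1).
    by apply: measurableT_comp => //; exact: measurable_Mk.
  - by apply: bounded_mfunM => //; exact: bounded_mfun_cst.
  - by move=> x; rewrite -mulrA norm_Mk_le.
apply: le_trans (ler_norm _) _; rewrite normrM.
apply: le_trans (ler_pM (normr_ge0 _) (normr_ge0 _) (H k k0) (H l l0)) _.
have -> : c * gamma ^+ k * (\int[Pp]_x `|t x|) * (c * gamma ^+ l * (\int[Pp]_x `|t x|)) =
    c ^+ 2 * gamma ^+ (k + l) * (\int[Pp]_x `|t x|) ^+ 2.
  by rewrite exprD; ring.
by rewrite [leRHS]mulrAC ler_wpM2l// mulr_ge0 ?exprn_ge0// ltW.
Qed.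

Variable B : R.
Hypothesis A3 : assumption3 Pp rp rm B.

(** A density bounded by B <= 0 would vanish and could not have total mass 1. Positivity is needed
    because the optimal threshold divides by a power of B. *)
Lemma density_bound_gt0 : 0 < B.
Proof.
have [f fB [mf f0 fE]] := A3; rewrite ltNge; apply/negP => B0.
have : pushforward Pp (log_psi rp rm) setT = 1%E.
  by rewrite /pushforward preimage_setT; exact: probability_setT.
rewrite fE// integral0_eq ?(@eqe _ 0)//.
  by move=> /eqP; rewrite eqe eq_sym oner_eq0.
by move=> x _; congr EFin; apply/eqP; rewrite eq_le f0 (le_trans (fB x)).
Qed.

Let Pp_small_ball z e : 0 <= e ->
  (Pp [set x | (`|log_psi rp rm x + z| <= e)%R] <= (2 * B * e)%:E)%E.
Proof.
move=> e0; have [f fB [mf f0 fE]] := A3.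
have -> : [set x | `|log_psi rp rm x + z| <= e] =
    log_psi rp rm @^-1` `[- z - e, - z + e].
  apply/seteqP; split => x /=; rewrite in_itv/= ler_norml.
    by move=> /andP[? ?]; apply/andP; split; lra.
  by move=> /andP[? ?]; apply/andP; split; lra.
set I := [set` _]; have mI : measurable I by exact: measurable_itv.
have := fE I mI; rewrite /pushforward => ->.
apply: (@le_trans _ _ (\int[lebesgue_measure]_(x in I) (cst B%:E x))%E).
  apply: ge0_le_integral => //.
  - by move=> x _; rewrite lee_fin.
  - exact/measurable_EFinP/measurable_funTS.
  - by move=> x _; rewrite lee_fin.
rewrite integral_cst//= /I lebesgue_measure_itv/= lte_fin.
case: ifPn => _; last by rewrite mule0 lee_fin !mulr_ge0// ltW// density_bound_gt0.
by rewrite -EFinB -EFinM lee_fin; lra.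
Qed.

(** Under P_+ an interval of length 2e has mass at most 2Be. The case of P_- follows through tau,
    which changes the sign of log psi and so turns the shift z into -z. *)
Lemma small_ball s z e : 0 <= e ->
  ((if s then Pp else Pm) [set x | (`|M 0 x + z| <= e)%R] <= (2 * B * e)%:E)%E.
Proof.
move=> e0; rewrite Mk0; case: s; first exact: Pp_small_ball.
have mL : measurable_fun setT (log_psi rp rm) by rewrite -Mk0; exact: measurable_Mk.
have mS z' : measurable [set x | `|log_psi rp rm x + z'| <= e].
  have mz : measurable_fun setT (fun x => `|log_psi rp rm x + z'|).
    by apply: measurableT_comp => //; exact: measurable_funD.
  have := mz measurableT `]-oo, e]%classic (measurable_itv _).
  rewrite setTI; set A := _ @^-1` _ => mA.
  suff -> : [set x | `|log_psi rp rm x + z'| <= e] = A by [].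
  by apply/seteqP; split => x; rewrite /A/= in_itv.
have [tau [mtau PmE [N [mN N0 subN]]]] := feature_symmetry.
set S' := [set x | `|log_psi rp rm x + - z| <= e].
have := Pp_small_ball (- z) e0; rewrite -/S'.
(* The densities are exchanged only off the null set N, so the preimage under tau is contained in N
   united with S', not in S' itself. *)
have mNS : measurable (N `|` S') by apply: measurableU => //; exact: mS.
have -> : Pp S' = Pp (N `|` S').
  apply/eqP; rewrite eq_le; apply/andP; split.
    by apply: le_measure; rewrite ?inE//; exact: mS.
  apply: le_trans (measureU2 _ mN (mS _)) _.
  by rewrite [X in (X + _)%E]N0 add0e.
apply: le_trans; rewrite (PmE _ (mS z)).
apply: le_measure; rewrite ?inE//.
- by rewrite -[_ @^-1` _]setTI; exact: mtau.
- move=> x /= H; have [Nx|nNx] := pselect (N x); [by left|right].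
  have [e1 e2] : rm x = rp (tau x) /\ rp x = rm (tau x).
    by apply: contrapT => nx; apply: nNx; exact: subN.
  rewrite /S'/= -normrN opprB; move: H; rewrite /log_psi -e1 -e2.
  have -> : ln (rm x / rp x) = - ln (rp x / rm x).
    have [rm00|rmx] := eqVneq (rm x) 0; first by rewrite rm00 invr0 mul0r mulr0 ln0 ?oppr0.
    have [rp00|rpx] := eqVneq (rp x) 0; first by rewrite rp00 invr0 mul0r mulr0 ln0 ?oppr0.
    by rewrite -invf_div lnV// posrE divr_gt0// lt_def ?rmx ?rpx ?rp0 ?rm0.
  by rewrite addrC.
Qed.

End feature_statistics.

(** * Generation sums of the full tree *)

Section generation_statistic.
Context (R : realType) (d : nat) (dO : measure_display)
  (Omega : measurableType dO) (P : probability Omega R)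
  (K : vertex -> {RV P >-> nat}) (y : vertex -> {RV P >-> bool})
  (X : vertex -> {RV P >-> d.-tuple R}).
Variable f : nat -> d.-tuple R -> R.
Hypothesis mf : forall k, measurable_fun setT (f k).

Definition gen_sum k w : R :=
  \sum_(v <- generation (fun v => K v w) k) f k (X v w).

Lemma cvg_truncated_sum k w :
  \forall n \near \oo, truncated_sum K X f n k w = gen_sum k w.
Proof.
have [N HN] := truncated_generation_eq (fun v => K v w) k.
by exists N => // n /= Nn; rewrite /truncated_sum HN.
Qed.

Lemma measurable_rest_truncated_sum n k : (0 < k)%N ->
  @measurable_fun _ _ (g_sigma_algebraType (rest_events K y X [::])) _ setT
    (truncated_sum K X f n k).
Proof.
(* Setting the term at the root to 0 makes every summand measurable without the root feature; for k
   > 0 the root is not in the list. *)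
move=> k0; pose g u w := if u == [::] then 0 else
  \1_[set w | intree (fun v => K v w) [::] u] w * f k (X u w).
have -> : truncated_sum K X f n k = fun w => \sum_(u <- words n k) g u w.
  apply/funext => w; rewrite /truncated_sum sum_truncated_generation.
  apply: eq_big_seq => u /size_generation uk; rewrite /g.
  case: eqP => [u0|_]; first by rewrite -uk u0 in k0.
  rewrite indicE; have [uT|uT] := boolP (intree _ _ u).
    by rewrite mem_set// mul1r mulr1n.
  by rewrite memNset ?mul0r ?mulr0n//; exact/negP.
elim: (words n k) => [|u s IH].
  by under eq_fun do rewrite big_nil; exact: measurable_cst.
under eq_fun do rewrite big_cons; apply: measurable_funD => //.
rewrite /g; have [_|u0] := eqVneq u [::]; first exact: measurable_cst.
apply: measurable_funM.
  apply: measurable_indic; apply: sub_sigma_algebra; apply: rest_events_tree.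
  exact: tree_events_intree.
move=> _ B mB; rewrite setTI; apply: sub_sigma_algebra.
have := mf k measurableT mB; rewrite setTI => mfB.
have u0' : [::] != u by rewrite eq_sym.
exact: (rest_events_feature K y X u0' mfB).
Qed.

Lemma measurable_rest_gen_sum k : (0 < k)%N ->
  @measurable_fun _ _ (g_sigma_algebraType (rest_events K y X [::])) _ setT
    (gen_sum k).
Proof.
move=> k0; apply: (@measurable_fun_cvg _ (g_sigma_algebraType (rest_events K y X [::]))
    R _ (fun n => truncated_sum K X f n k)).
  by move=> n; exact: measurable_rest_truncated_sum.
move=> w _; apply: cvg_near_cst; exact: cvg_truncated_sum.
Qed.

End generation_statistic.

(** * Anti-concentration of T_l *)

Section statistic_small_ball.
Context (R : realType) (d : nat) (dO : measure_display)
  (Omega : measurableType dO) (P : probability Omega R) (Delta gamma : R)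
  (Pp Pm : probability (d.-tuple R) R)
  (K : vertex -> {RV P >-> nat}) (y : vertex -> {RV P >-> bool})
  (X : vertex -> {RV P >-> d.-tuple R}).
Variables (mu : {measure set (d.-tuple R) -> \bar R}) (rp rm : d.-tuple R -> R).
Variable B : R.
Hypothesis limit_object : is_limit_object Delta gamma Pp Pm K y X.
Hypothesis A1 : assumption1 mu Pp Pm rp rm.
Hypothesis A3 : assumption3 Pp rp rm B.
Hypothesis gamma01 : 0 < gamma < 1.

Let M := Mk rp rm gamma.
Let T := Tell rp rm gamma K X.

Lemma TellE l w :
  T l w = M 0 (X [::] w) + \sum_(k < l) gen_sum K X M k.+1 w.
Proof. by rewrite /T /Tell big_ord_recl/= big_seq1. Qed.

Let measurable_rest_tail l :
  @measurable_fun _ _ (g_sigma_algebraType (rest_events K y X [::])) _ setT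
    (fun w => \sum_(k < l) gen_sum K X M k.+1 w).
Proof.
apply: measurable_sum => k; apply: measurable_rest_gen_sum => //.
exact: (measurable_Mk A1 gamma01).
Qed.

Lemma measurable_gen_sum k : (0 < k)%N -> measurable_fun setT (gen_sum K X M k).
Proof.
move=> k0; apply: (@rest_measurable_fun _ _ _ _ _ K y X _ _ [::]).
apply: measurable_rest_gen_sum => // j; exact: (measurable_Mk A1 gamma01).
Qed.

Lemma measurable_Tell l : measurable_fun setT (T l).
Proof.
rewrite (_ : T l = fun w => M 0 (X [::] w) + \sum_(k < l) gen_sum K X M k.+1 w).
  apply: measurable_funD.
    apply: (measurableT_comp (measurable_Mk A1 gamma01 0)).
    exact: measurable_funPT.
  by apply: measurable_sum => k; exact: measurable_gen_sum.
by apply/funext => w; rewrite TellE.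
Qed.

(** On each event {y_o = s}, the root feature is integrated out with the remaining sum Z frozen. The
    bound of [small_ball] is uniform in the shift and in s, so the two labels add up to total mass
    1. *)
Lemma Tell_small_ball l e : 0 <= e ->
  (P [set w | (`|T l w| <= e)%R] <= (2 * B * e)%:E)%E.
Proof.
move=> e0; set A := [set w | _].
pose Z w := \sum_(k < l) gen_sum K X M k.+1 w.
pose D := [set p : d.-tuple R * R | `|M 0 p.1 + p.2| <= e].
pose h p : \bar R := (\1_D p)%:E.
have mD : measurable D.
  have mN : measurable_fun setT (fun p : d.-tuple R * R => `|M 0 p.1 + p.2|).
    apply: measurableT_comp => //; apply: measurable_funD => //.
    exact: (measurableT_comp (measurable_Mk A1 gamma01 0)).
  have := mN measurableT `]-oo, e]%classic (measurable_itv _).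
  rewrite setTI; set C := _ @^-1` _ => mC; suff -> : D = C by [].
  by apply/seteqP; split => p; rewrite /C/= in_itv.
have mh : measurable_fun setT h by exact/measurable_EFinP/measurable_indic.
have h0 p : (0 <= h p)%E by rewrite lee_fin.
have hA w : h (X [::] w, Z w) = (\1_A w)%:E.
  congr EFin; rewrite !indicE; congr (_%:R); congr nat_of_bool.
  by apply/idP/idP; rewrite !inE /A/= TellE.
have mA : measurable A.
  have mN : measurable_fun setT (fun w => `|T l w|).
    by apply: measurableT_comp => //; exact: measurable_Tell.
  have := mN measurableT `]-oo, e]%classic (measurable_itv _).
  rewrite setTI; set C := _ @^-1` _ => mC; suff -> : A = C by [].
  by apply/seteqP; split => p; rewrite /C/= in_itv.
pose Y s := y [::] @^-1` [set s].
have mY s : measurable (Y s).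
  by rewrite /Y -[_ @^-1` _]setTI; exact: measurable_funPT.
have B0 : 0 <= 2 * B * e by rewrite !mulr_ge0// ltW// (density_bound_gt0 A3).
have bound s : (P (Y s `&` A) <= (2 * B * e)%:E * P (Y s))%E.
  have mYs : measurable (y [::] @^-1` [set s]) := mY s.
  rewrite setIC -[P (A `&` _)]integral_indic//.
  under eq_integral do rewrite -hA.
  rewrite (integral_feature limit_object s (measurable_rest_tail l) mh h0).
  rewrite -integral_cst//; apply: ge0_le_integral => //.
  - by move=> w _; exact: integral_ge0.
  - apply: measurable_funTS.
    pose Q (s : bool) := if s then Pp else Pm.
    apply: (measurableT_comp (f := fun z => (\int[Q s]_x h (x, z))%E)).
      exact: (measurable_fun_fubini_tonelli_G (m1 := Q s)).
    by apply: measurable_sum => k; exact: measurable_gen_sum.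
  move=> w _.
  have mDw : measurable [set x | (`|M 0 x + Z w| <= e)%R].
    rewrite (_ : mkset _ = ysection D (Z w)); first exact: measurable_ysection.
    by apply/seteqP; split => x; rewrite /ysection/= inE.
  have -> : (\int[(if s then Pp else Pm)]_x h (x, Z w) =
      (if s then Pp else Pm) [set x | (`|M 0 x + Z w| <= e)%R])%E.
    by rewrite -(setIT [set x | (`|M 0 x + Z w| <= e)%R]) -integral_indic//.
  exact: (small_ball A1 gamma01 A3).
have -> : A = (Y true `&` A) `|` (Y false `&` A).
  by apply/seteqP; split => [w Aw|w [] []//]; rewrite /Y/=; case: (y [::] w); [left|right].
apply: le_trans (measureU2 _ (measurableI _ _ (mY _) mA) (measurableI _ _ (mY _) mA)) _.
apply: le_trans (leeD (bound true) (bound false)) _.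
rewrite -ge0_muleDr// -measureU//; last first.
  by apply/seteqP; split => // w []; rewrite /Y/= => ->.
rewrite -[leRHS]mule1; apply: lee_wpmul2l; first by rewrite lee_fin.
by apply: probability_le1; exact: measurableU.
Qed.

End statistic_small_ball.

(** * Limits in mean square *)

Section mean_square_limit.
Context (R : realType) (dT : measure_display) (Omega : measurableType dT).
Variable P : probability Omega R.

Lemma fatou_le (f_ : nat -> Omega -> R) (f : Omega -> R) (C : \bar R) :
  (forall n, measurable_fun setT (f_ n)) -> measurable_fun setT f ->
  (forall n w, 0 <= f_ n w) -> (forall w, 0 <= f w) ->
  {ae P, forall w, f_ n w @[n --> \oo] --> f w} ->
  (\forall n \near \oo, (\int[P]_w (f_ n w)%:E <= C)%E) ->
  (\int[P]_w (f w)%:E <= C)%E.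
Proof.
move=> mf_ mf f_0 f0 f_f fC.
have mEf n : measurable_fun setT (EFin \o f_ n) by exact/measurable_EFinP.
have f_ge0 n (w : Omega) : setT w -> (0 <= (EFin \o f_ n) w)%E.
  by move=> _; rewrite lee_fin.
apply: le_trans (_ : \int[P]_w limn_einf (fun n => (f_ n w)%:E) <= _)%E.
  rewrite le_eqVlt; apply/orP; left; apply/eqP.
  apply: ae_eq_integral => //.
  - exact/measurable_EFinP.
  - rewrite (_ : (fun w => limn_einf _) =
        (fun w => - limn_esup (fun n => (- (f_ n w)%:E)))%E).
      apply: measurableT_comp => //; apply: measurable_fun_limn_esup => n.
      by apply: measurableT_comp => //; exact: mEf.
    apply/funext => w; rewrite /limn_einf.
    by [].
  - apply: filterS f_f => w fw _.
    have : (f_ n w)%:E @[n --> \oo] --> (f w)%:E by apply: cvg_EFin => //; near=> n.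
    by move/cvg_limn_einf_sup => [-> _].
apply: le_trans (fatou P measurableT mEf f_ge0) _.
rewrite limn_einf_lim; apply: lime_le; first exact: is_cvg_einfs.
apply: filterS fC => n; apply: le_trans.
by apply: ereal_inf_lbound; exists n => /=.
Unshelve. all: by end_near. Qed.

(* With r in (0,1) the weights r^k in |a| <= (a^2 / r^k + r^k) / 2 make the sum
   of the E|T_(k+1) - T_k| finite, hence T_n converges almost surely. *)
Lemma ae_cvg_geometric (T : nat -> Omega -> R) (W r : R) : 0 <= W -> 0 < r < 1 ->
  (forall n, measurable_fun setT (T n)) ->
  (forall n, (\int[P]_w ((T n.+1 w - T n w) ^+ 2)%:E <= (W * r ^+ n.*2)%:E)%E) ->
  {ae P, forall w, cvgn (T ^~ w)}.
Proof.
move=> W0 /andP[r0 r1] mT TW.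
have mD n : measurable_fun setT (fun w => T n.+1 w - T n w) by exact: measurable_funB.
have mN n : measurable_fun setT (fun w => `|T n.+1 w - T n w|%:E).
  by apply/measurable_EFinP; exact: measurableT_comp.
have step n : (\int[P]_w `|T n.+1 w - T n w|%:E <= ((W + 1) / 2 * r ^+ n)%:E)%E.
  have rn0 : 0 < r ^+ n by rewrite exprn_gt0.
  apply: le_trans (_ : \int[P]_w ((2 * r ^+ n)^-1%:E * ((T n.+1 w - T n w) ^+ 2)%:E +
      (r ^+ n / 2)%:E) <= _)%E.
    apply: ge0_le_integral => //.
    - apply: emeasurable_funD => //; apply: emeasurable_funM => //.
      by apply/measurable_EFinP; exact: measurable_funX.
    - move=> w _; rewrite -EFinM -EFinD lee_fin.
      set a := T n.+1 w - T n w; rewrite -(real_normK (num_real a)).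
      have : 0 <= (2 * r ^+ n)^-1 * (`|a| - r ^+ n) ^+ 2.
        by rewrite mulr_ge0 ?sqr_ge0// invr_ge0 mulr_ge0// ltW.
      rewrite -subr_ge0 => H; apply: le_trans H _.
      rewrite le_eqVlt; apply/orP; left; apply/eqP; field.
      by rewrite gt_eqF.
  have mX : measurable_fun setT (fun w => ((T n.+1 w - T n w) ^+ 2)%:E).
    by apply/measurable_EFinP; exact: measurable_funX.
  have X0 w : (0 <= ((T n.+1 w - T n w) ^+ 2)%:E)%E by rewrite lee_fin sqr_ge0.
  have c0 : (0 <= (2 * r ^+ n)^-1%:E)%E by rewrite lee_fin invr_ge0 mulr_ge0// ltW.
  have d0 : (0 <= (r ^+ n / 2)%:E)%E by rewrite lee_fin divr_ge0// ltW.
  rewrite (ge0_integralD P measurableT (fun w _ => mule_ge0 c0 (X0 w))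
    (measurable_funeM _ mX))//.
  rewrite ge0_integralZl//.
  rewrite integral_cst//.
  apply: le_trans (leeD (lee_wpmul2l _ (TW n))
    (lee_wpmul2l _ (probability_le1 P measurableT))) _.
  - exact: c0.
  - exact: d0.
  rewrite mule1 -EFinM -EFinD lee_fin -addnn exprD.
  rewrite le_eqVlt; apply/orP; left; apply/eqP; field.
  by rewrite gt_eqF.
have sumfin : (\int[P]_w \sum_(0 <= k <oo) `|T k.+1 w - T k w|%:E < +oo)%E.
  rewrite integral_nneseries//.
  apply: (@le_lt_trans _ _ ((W + 1) / 2 / (1 - r))%:E); last by rewrite ltry.
  apply: lime_le.
    by apply: is_cvg_nneseries => n _ _; exact: integral_ge0.
  apply: nearW => n.
  apply: (@le_trans _ _ (\sum_(0 <= k < n) ((W + 1) / 2 * r ^+ k)%:E)%E).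
    by apply: lee_sum => k _; exact: step.
  rewrite sumEFin lee_fin -big_distrr/= ler_wpM2l ?divr_ge0 ?addr_ge0//.
  have r1' : 1 - r != 0 by rewrite subr_eq0 eq_sym lt_eqF.
  rewrite -[leRHS]mul1r ler_pdivlMr ?subr_gt0// big_mkord.
  by rewrite mulrC -opprB mulNr -subrX1 opprB gerBl exprn_ge0// ltW.
have intg : P.-integrable setT (fun w => \sum_(0 <= k <oo) `|T k.+1 w - T k w|%:E)%E.
  apply/integrableP; split.
    by apply: ge0_emeasurable_sum => //.
  under eq_integral do rewrite gee0_abs ?nneseries_ge0//.
  exact: sumfin.
have := integrable_ae measurableT intg; apply: filterS => w /(_ I) gw.
have cs : cvgn (series (telescope (T ^~ w))).
  apply: normed_cvg.
  rewrite (_ : [normed series _] =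
    (fun m => \sum_(0 <= k < m) `|T k.+1 w - T k w|)); last exact/funext.
  apply: nondecreasing_is_cvgn.
    by apply/nondecreasing_seqP => n; rewrite big_nat_recr//= lerDl.
  exists (fine (\sum_(0 <= k <oo) `|T k.+1 w - T k w|%:E)%E) => _ [n _ <-].
  rewrite -lee_fin fineK// -sumEFin.
  exact: nneseries_lim_ge.
rewrite (_ : T ^~ w = (fun n => T 0 w + series (telescope (T ^~ w)) n)).
  by apply: is_cvgD => //; exact: is_cvg_cst.
by apply/funext => n; exact: eq_sum_telescope.
Qed.

(** Almost sure convergence provides the limit; Fatou's lemma in m, with n fixed, transfers the
    Cauchy bound to it at the same rate. *)
Lemma mean_square_limit (T : nat -> Omega -> R) (W r : R) : 0 <= W -> 0 < r < 1 ->
  (forall n, measurable_fun setT (T n)) ->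
  (forall n m, (n <= m)%N ->
    (\int[P]_w ((T m w - T n w) ^+ 2)%:E <= (W * r ^+ n.*2)%:E)%E) ->
  exists Tinf : {RV P >-> R}, forall n,
    (\int[P]_w ((Tinf w - T n w) ^+ 2)%:E <= (W * r ^+ n.*2)%:E)%E.
Proof.
move=> W0 r01 mT TW.
(* The limsup is measurable and defined everywhere, and it equals the limit wherever the sequence
   converges. *)
pose S w := fine (limn_esup (fun n => (T n w)%:E)).
have mS : measurable_fun setT S.
  apply: (measurableT_comp (fine_measurable measurableT)).
  by apply: measurable_fun_limn_esup => n; exact/measurable_EFinP.
pose Tinf : {RV P >-> R} := HB.pack S (isMeasurableFun.Build _ _ _ _ S mS).
exists Tinf => n.
apply: (@fatou_le (fun m w => (T m w - T n w) ^+ 2)).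
- by move=> m; apply: measurable_funX; exact: measurable_funB.
- by apply: measurable_funX; exact: measurable_funB.
- by move=> m w; exact: sqr_ge0.
- by move=> w; exact: sqr_ge0.
- have : {ae P, forall w, cvgn (T ^~ w)}.
    by apply: (ae_cvg_geometric W0 r01 mT) => m; exact: TW.
  apply: filterS => w /cvg_ex[l Tl].
  have -> : Tinf w = l.
    rewrite /Tinf/= /S.
    have : (T m w)%:E @[m --> \oo] --> l%:E by apply: cvg_EFin => //; near=> m.
    by move/cvg_limn_einf_sup => [_ ->].
  by rewrite expr2; under eq_fun do rewrite expr2;
    apply: cvgM; apply: cvgB => //; exact: cvg_cst.
- by exists n => // m /= nm; exact: TW.
Unshelve. all: by end_near. Qed.

End mean_square_limit.

(** * Comparison of error probabilities *)

Section error_comparison.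
Context (R : realType) (dO : measure_display) (Omega : measurableType dO).
Variables (P : probability Omega R) (yo : {RV P >-> bool}).

Let measurable_le (S : Omega -> R) (c : R) : measurable_fun setT S ->
  measurable [set w | S w <= c].
Proof.
move=> mS; have := mS measurableT `]-oo, c]%classic (measurable_itv _).
rewrite setTI; set C := _ @^-1` _ => mC; suff -> : [set w | S w <= c] = C by [].
by apply/seteqP; split => w; rewrite /C/= in_itv.
Qed.

Let measurable_error (S : Omega -> R) : measurable_fun setT S ->
  measurable [set w | sgl R (yo w) * S w <= 0].
Proof.
move=> mS; apply: measurable_le; apply: measurable_funM => //.
by apply: (measurableT_comp (f := sgl R)) => //; exact: measurable_funPT.
Qed.

Lemma second_moment_markov (S : Omega -> R) (V e : R) : measurable_fun setT S ->
  0 < e -> (\int[P]_w ((S w) ^+ 2)%:E <= V%:E)%E ->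
  (P [set w | (e <= `|S w|)%R] <= (V / e ^+ 2)%:E)%E.
Proof.
move=> mS e0 SV; set A := mkset _.
have mA : measurable A.
  rewrite (_ : A = [set w | - `|S w| <= - e]).
    by apply: measurable_le; apply: measurableT_comp => //; exact: measurableT_comp.
  by apply/seteqP; split => w; rewrite /A/= lerN2.
have e2 : 0 < e ^+ 2 by rewrite exprn_gt0.
have mX : measurable_fun setT (fun w => (S w ^+ 2)%:E).
  by apply/measurable_EFinP; exact: measurable_funX.
rewrite mulrC EFinM lee_pdivlMl//; apply: le_trans SV.
rewrite -integral_cst//.
apply: le_trans (_ : \int[P]_(w in A) ((S w) ^+ 2)%:E <= _)%E.
  apply: ge0_le_integral => //.
  - by move=> w _; rewrite lee_fin ltW.
  - exact: measurable_funTS.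
  - move=> w Aw; rewrite lee_fin -(real_normK (num_real (S w))).
    by apply: lerXn2r => //; rewrite nnegrE ltW.
apply: ge0_subset_integral => //.
by move=> w _; rewrite lee_fin sqr_ge0.
Qed.

(** The two statistics lie on opposite sides of 0, hence |S - T| = |S| + |T|. *)
Let error_change (T S : Omega -> R) w :
  sgl R (yo w) * T w <= 0 -> 0 < sgl R (yo w) * S w ->
  `|T w| <= `|S w - T w| /\ `|S w| <= `|S w - T w|.
Proof.
rewrite /sgl; case: (yo w); rewrite ?mul1r ?mulN1r => T0 S0.
  by rewrite ler0_norm// !ger0_norm; [split; lra|lra..].
by rewrite (ger0_norm (x := T w)) ?ler0_norm; [split; lra|lra..].
Qed.

Lemma error_prob_close (T S : Omega -> R) (B V : R) :
  measurable_fun setT T -> measurable_fun setT S -> 0 < B -> 0 < V ->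
  (forall e, 0 <= e -> (P [set w | (`|T w| <= e)%R] <= (2 * B * e)%:E)%E) ->
  (\int[P]_w ((S w - T w) ^+ 2)%:E <= V%:E)%E ->
  `|error_prob P yo T - error_prob P yo S| <=
    3 * B `^ (2 / 3) * V `^ (1 / 3).
Proof.
move=> mT mS B0 V0 ball SV.
(* With e = (V/B)^(1/3) both B e and V/e^2 equal B^(2/3) V^(1/3), so the total is 2 + 1 = 3 times
   that. Naming the cube roots makes this a rational identity. *)
pose b := B `^ (1 / 3); pose v := V `^ (1 / 3); pose e := v / b.
have b0 : 0 < b by exact: powR_gt0.
have v0 : 0 < v by exact: powR_gt0.
have e0 : 0 < e by exact: divr_gt0.
have cube (z : R) : 0 < z -> z = (z `^ (1 / 3)) ^+ 3.
  move=> z0; rewrite -powR_mulrn ?powR_ge0// -powRrM.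
  by rewrite (_ : 1 / 3 * 3 = 1) ?powRr1 ?ltW//; field.
have b2 : B `^ (2 / 3) = b ^+ 2.
  by rewrite -powR_mulrn ?powR_ge0// -powRrM; congr (_ `^ _); field.
have E : 2 * B * e + V / e ^+ 2 = 3 * B `^ (2 / 3) * V `^ (1 / 3).
  rewrite b2 -/v (cube _ B0) (cube _ V0) -/b -/v /e; field.
  by rewrite !gt_eqF.
have mD : measurable_fun setT (fun w => S w - T w) by exact: measurable_funB.
have mA1 : measurable [set w | `|T w| <= e].
  by apply: measurable_le; exact: measurableT_comp.
have mA2 : measurable [set w | e <= `|S w - T w|].
  rewrite (_ : mkset _ = [set w | - `|S w - T w| <= - e]).
    by apply: measurable_le; apply: measurableT_comp => //; exact: measurableT_comp.
  by apply/seteqP; split => w /=; rewrite lerN2.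
have mA := measurableU _ _ mA1 mA2.
have sum_le : (P ([set w | (`|T w| <= e)%R] `|` [set w | (e <= `|S w - T w|)%R]) <=
    (2 * B * e + V / e ^+ 2)%:E)%E.
  apply: le_trans (measureU2 _ mA1 mA2) _; rewrite EFinD.
  by apply: leeD; [exact/ball/ltW|exact: second_moment_markov].
(* Both signs of the difference use the same bad event, whose small-ball part concerns T alone:
   whichever statistic errs, |T| <= |S - T|. *)
have half (U W : Omega -> R) : measurable_fun setT U -> measurable_fun setT W ->
    [set w | sgl R (yo w) * U w <= 0] `<=` [set w | sgl R (yo w) * W w <= 0] `|`
      ([set w | `|T w| <= e] `|` [set w | e <= `|S w - T w|]) ->
    error_prob P yo U - error_prob P yo W <= 2 * B * e + V / e ^+ 2.
  move=> mU mW UW; rewrite lerBlDl -lee_fin EFinD.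
  rewrite /error_prob !fineK ?fin_num_measure//; try exact: measurable_error.
  apply: (@le_trans _ _ (P ([set w | (sgl R (yo w) * W w <= 0)%R] `|`
      ([set w | (`|T w| <= e)%R] `|` [set w | (e <= `|S w - T w|)%R])))).
    apply: le_measure => //; rewrite inE; first exact: measurable_error.
    by apply: measurableU => //; exact: measurable_error.
  apply: le_trans (measureU2 _ (measurable_error mW) mA) _.
  exact: leeD.
rewrite -E ler_norml lerNl opprB; apply/andP; split; apply: half => // w /= err.
  have [T0|T0] := leP (sgl R (yo w) * T w) 0; [by left|right].
  have [|SD] := leP e `|S w - T w|; [by right|left].
  by rewrite ltW// (le_lt_trans _ SD)// distrC; have [] := error_change err T0.
have [S0|S0] := leP (sgl R (yo w) * S w) 0; [by left|right].
have [|SD] := leP e `|S w - T w|; [by right|left].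
by rewrite ltW// (le_lt_trans _ SD)//; have [] := error_change err S0.
Qed.

End error_comparison.

(** * Second moment of T_l' - T_l on the full tree *)

Section generation_second_moment.
Context (R : realType) (d : nat) (dO : measure_display)
  (Omega : measurableType dO) (P : probability Omega R) (Delta gamma : R)
  (Pp Pm : probability (d.-tuple R) R)
  (K : vertex -> {RV P >-> nat}) (y : vertex -> {RV P >-> bool})
  (X : vertex -> {RV P >-> d.-tuple R}).
Variables (mu : {measure set (d.-tuple R) -> \bar R}) (rp rm : d.-tuple R -> R).
Hypothesis limit_object : is_limit_object Delta gamma Pp Pm K y X.
Hypothesis A1 : assumption1 mu Pp Pm rp rm.
Hypothesis gamma01 : 0 < gamma < 1.
Hypothesis Delta0 : 0 < Delta.
Let kappa := gamma ^+ 2 * Delta.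
Hypothesis kappa1 : kappa < 1.
Let theta := vartheta Pp rp rm.
Hypothesis theta0 : 0 < theta.

Let M := Mk rp rm gamma.
Let T := Tell rp rm gamma K X.
Let A := (2 / (1 - gamma ^+ 2)) ^+ 2 * theta.

Lemma second_moment_Tell l l' : (l <= l')%N ->
  (\int[P]_w ((T l' w - T l w) ^+ 2)%:E <=
   (2 * A / (1 - kappa) ^+ 3 * kappa ^+ l.+1)%:E)%E.
Proof.
move=> /subnKC <-; set N := (l' - l)%N.
have gamma0 : 0 <= gamma by have /andP[/ltW] := gamma01.
have mT k : measurable_fun setT (T k) := measurable_Tell K y X A1 gamma01 k.
have bM k : (0 < k)%N -> bounded_mfun (M k) := bounded_Mk A1 gamma01 (k := k).
have bS n i : bounded_mfun (truncated_sum K X M n (l.+1 + i)).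
  by apply: (bounded_truncated_sum K y X bM); rewrite addSn.
(* The root term and the first l generations cancel, so only indices k >= 1 remain. *)
have diff w : T (l + N)%N w - T l w = \sum_(i < N) gen_sum K X M (l.+1 + i) w.
  rewrite /T !TellE big_split_ord/= opprD addrACA subrr add0r addrAC subrr add0r.
  by apply: eq_bigr => i _; rewrite addSn.
pose F n w := (\sum_(i < N) truncated_sum K X M n (l.+1 + i) w) ^+ 2.
have bF n : bounded_mfun (F n).
  rewrite /F; under eq_fun do rewrite expr2.
  by apply: bounded_mfunM; apply: bounded_mfun_sum => i.
apply: (@fatou_le _ _ _ P F).
- by move=> n; have [] := bF n.
- by apply: measurable_funX; exact: measurable_funB.
- by move=> n w; exact: sqr_ge0.
- by move=> w; exact: sqr_ge0.
- apply: aeW => w; rewrite diff /F.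
  have cv : (\sum_(i < N) truncated_sum K X M n (l.+1 + i) w) @[n --> \oo] -->
      \sum_(i < N) gen_sum K X M (l.+1 + i) w.
    elim: N {F bF diff} => [|N IH].
      by under eq_fun do rewrite big_ord0; rewrite big_ord0; exact: cvg_cst.
    under eq_fun do rewrite big_ord_recr/=; rewrite big_ord_recr/=.
    by apply: cvgD => //; apply: cvg_near_cst; exact: cvg_truncated_sum.
  by rewrite expr2; under eq_fun do rewrite expr2; exact: cvgM.
- apply: nearW => n.
  have := truncated_second_moment Delta0 gamma0 limit_object bM
    (fun k => Rintegral_Mk A1 gamma01 (k := k))
    (fun k => Rintegral_Mk2 A1 gamma01 (k := k))
    (fun k l => mean_Mk_le A1 gamma01 (k := k) (l := l))
    (fun k => square_Mk_le A1 gamma01 (k := k)) _ kappa1 n l N.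
  rewrite -lee_fin fineK; last first.
    by apply: integrable_fin_num => //; exact: (bounded_mfun_integrable _ (bF n)).
  by apply; rewrite mulr_ge0 ?sqr_ge0// ltW.
Qed.

End generation_second_moment.

Theorem theorem3p1 (R : realType) (a b : R) (d : nat)
    (mu : {measure set (d.-tuple R) -> \bar R})
    (Pp Pm : probability (d.-tuple R) R) (rp rm : d.-tuple R -> R) (B : R)
    (dO : measure_display) (Omega : measurableType dO)
    (P : probability Omega R)
    (K : vertex -> {RV P >-> nat}) (y : vertex -> {RV P >-> bool})
    (X : vertex -> {RV P >-> d.-tuple R}) :
  let Delta := (a + b) / 2 in
  let gamma := (a - b) / (a + b) in
  let kappa := gamma ^+ 2 * Delta in
  let theta := vartheta Pp rp rm in
  let c_gamma := 2 / (1 - gamma ^+ 2) in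
  let C1 := 3 * c_gamma ^+ 2 * theta / (1 - kappa) ^+ 3 in
  let T := Tell rp rm gamma K X in
  let Err := fun l => error_prob P (y [::]) (T l) in
  let bound := fun l : nat =>
    3 * B `^ (2 / 3) * C1 `^ (1 / 3) * kappa `^ ((l%:R + 1) / 3) in
  0 < b -> b < a -> 1 < Delta ->
  is_limit_object Delta gamma Pp Pm K y X ->
  assumption1 mu Pp Pm rp rm ->
  0 < theta ->
  assumption3 Pp rp rm B ->
  kappa < 1 ->
  (forall l l' : nat, (l < l')%N -> `|Err l - Err l'| <= bound l) /\
  exists Einf : R,
    [/\ Err l @[l --> \oo] --> Einf,
        forall l : nat, `|Err l - Einf| <= bound l &
        exists Tinf : {RV P >-> R},
          ('E_P[(fun w => (T l w - Tinf w) ^+ 2)%R] @[l --> \oo] --> 0)%E /\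
          Einf = error_prob P (y [::]) Tinf].
Proof.
move=> Delta gamma kappa theta c C1 T Err bound b0 ba Delta1 lim A1 theta0 A3 kappa1.
have a0 : 0 < a by exact: lt_trans ba.
have ab0 : 0 < a + b by exact: addr_gt0.
have gamma0 : 0 < gamma by rewrite divr_gt0// subr_gt0.
have gamma1 : gamma < 1 by rewrite ltr_pdivrMr// mul1r; lra.
have gamma01 : 0 < gamma < 1 by rewrite gamma0.
have Delta0 : 0 < Delta by exact: lt_trans Delta1.
have kappa0 : 0 < kappa by rewrite mulr_gt0// exprn_gt0.
have B0 : 0 < B by exact: (density_bound_gt0 A3).
have K0 : 0 < 1 - kappa by rewrite subr_gt0.
have c0 : 0 < c by rewrite divr_gt0// subr_gt0 expr_lt1// ltW.
have C0 : 0 < C1 by rewrite /C1 divr_gt0 ?exprn_gt0// mulr_gt0// mulr_gt0// exprn_gt0.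
have mT l : measurable_fun setT (T l) := measurable_Tell K y X A1 gamma01 l.
have ball l := Tell_small_ball lim A1 A3 gamma01 l.
(* The second-moment bound gives the constant 2 where [C1] has 3, so [W] is at most [C1]. *)
pose W := 2 * (c ^+ 2 * theta) / (1 - kappa) ^+ 3.
have W0 : 0 < W by rewrite /W divr_gt0 ?exprn_gt0// mulr_gt0// mulr_gt0// exprn_gt0.
have WC : W <= C1.
  rewrite /W /C1 ler_wpM2r ?invr_ge0 ?exprn_ge0 ?(ltW K0)// -[leRHS]mulrA ler_wpM2r//.
    by rewrite mulr_ge0 ?sqr_ge0// ltW.
  by rewrite ler_nat.
have moment l l' : (l <= l')%N ->
    (\int[P]_w ((T l' w - T l w) ^+ 2)%:E <= (W * kappa ^+ l.+1)%:E)%E.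
  exact: (second_moment_Tell lim A1 gamma01 Delta0 kappa1 theta0).
have boundE l : bound l = 3 * B `^ (2 / 3) * (C1 * kappa ^+ l.+1) `^ (1 / 3).
  rewrite /bound (powRM (1 / 3) (ltW C0) (exprn_ge0 l.+1 (ltW kappa0))) mulrA.
  congr (_ * _).
  by rewrite -(powR_mulrn l.+1 (ltW kappa0)) -powRrM natr1 mul1r.
have close l (S : Omega -> R) : measurable_fun setT S ->
    (\int[P]_w ((S w - T l w) ^+ 2)%:E <= (W * kappa ^+ l.+1)%:E)%E ->
    `|Err l - error_prob P (y [::]) S| <= bound l.
  move=> mS SW; rewrite boundE; apply: error_prob_close => //.
  - by rewrite mulr_gt0// exprn_gt0.
  - exact: ball.
  - by apply: le_trans SW _; rewrite lee_fin ler_wpM2r// exprn_ge0// ltW.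
split; first by move=> l l' ll'; apply: close => //; exact/moment/ltnW.
(* [mean_square_limit] expects the rate r^(2n): the square root of kappa gives kappa^n, and the
   remaining factor of kappa^(n+1) goes into the constant. *)
have r0 : 0 < Num.sqrt kappa by rewrite sqrtr_gt0.
have r1 : Num.sqrt kappa < 1 by rewrite -sqrtr1 ltr_sqrt.
have rE l : W * kappa * Num.sqrt kappa ^+ l.*2 = W * kappa ^+ l.+1.
  by rewrite -mul2n exprM (sqr_sqrtr (ltW kappa0)) [kappa ^+ l.+1]exprS [in RHS]mulrA.
have r01 : 0 < Num.sqrt kappa < 1 by rewrite r0.
have Wk0 : 0 <= W * kappa by rewrite mulr_ge0// ltW.
have moment' n m : (n <= m)%N -> (\int[P]_w ((T m w - T n w) ^+ 2)%:E <=
    (W * kappa * Num.sqrt kappa ^+ n.*2)%:E)%E.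
  by rewrite rE; exact: moment.
have [Tinf TinfE] := mean_square_limit Wk0 r01 mT moment'.
have {}TinfE l : (\int[P]_w ((Tinf w - T l w) ^+ 2)%:E <= (W * kappa ^+ l.+1)%:E)%E.
  by rewrite -rE.
have mTinf : measurable_fun setT Tinf by exact: measurable_funPT.
have Errle l : `|Err l - error_prob P (y [::]) Tinf| <= bound l by exact: close.
exists (error_prob P (y [::]) Tinf); split => //.
  (* As a function of l the bound is geometric with ratio kappa^(1/3) < 1, hence tends to 0. *)
  pose r := kappa `^ (1 / 3).
  have rr0 : 0 < r by exact: powR_gt0.
  have rr1 : r < 1.
    have -> : 1 = 1 `^ (1 / 3) :> R by rewrite powR1.
    by apply: gt0_ltr_powR => //; rewrite nnegrE ltW.
  have bE l : bound l = 3 * B `^ (2 / 3) * C1 `^ (1 / 3) * r * r ^+ l.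
    rewrite /bound -[RHS]mulrA -exprS; congr (_ * _).
    by rewrite -(powR_mulrn l.+1 (powR_ge0 _ _)) -powRrM natr1 mul1r mulrC.
  apply/cvgrPdist_le => e e0.
  have : bound l @[l --> \oo] --> 0.
    rewrite (_ : bound = geometric (3 * B `^ (2 / 3) * C1 `^ (1 / 3) * r) r).
      by apply: cvg_geometric; rewrite ger0_norm// ltW.
    by apply/funext => l; rewrite bE.
  move/cvgrPdist_le => /(_ _ e0); apply: filterS => l; rewrite sub0r normrN => be.
  by rewrite distrC (le_trans (Errle l))// (le_trans (ler_norm _)).
exists Tinf; split => //.
apply: (@squeeze_cvge _ _ _ _ (cst 0%E) _ (fun l => (W * kappa ^+ l.+1)%:E)).
- apply: nearW => l; rewrite unlock; apply/andP; split.
    by apply: integral_ge0 => w _; rewrite lee_fin sqr_ge0.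
  apply: le_trans (TinfE l).
  rewrite le_eqVlt; apply/orP; left; apply/eqP; apply: eq_integral => w _.
  by rewrite -sqrrN opprB.
- exact: cvg_cst.
- rewrite -[X in _ --> X]/(0%:E); apply: cvg_EFin; first exact: nearW.
  rewrite (_ : _ \o _ = geometric (W * kappa) kappa).
    by apply: cvg_geometric; rewrite ger0_norm// ltW.
  by apply/funext => l; rewrite /= exprS mulrA.
Qed.
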